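(* Suppose that $F\in L^2_{\mathbb{X}}$ and that $h:\mathbb{R}\to\mathbb{R}$ is either Lipschitz-continuous with Lipschitz constant $1$ or $h=h_z=\mathbf{1}_{(-\infty,z]}$ for some $z\in\mathbb{R}$. Let $\psi_h$ be the Stein solution and $\psi_h'$ its (everywhere defined) derivative in the sense of the context. Then, for $k\in\mathbb{N}$, $$D_k\psi_h(F)=\psi_h'(F)\,D_kF-S_k-\mathbb{E}[R_k\mid\mathcal{G}_k],$$ where the random variables $R_k$ and $S_k$ are defined by $$\psi_h(F)-\psi_h\bigl(\mathbb{E}[F\mid\mathcal{G}_k]\bigr)=\psi_h'\bigl(\mathbb{E}[F\mid\mathcal{G}_k]\bigr)D_kF+R_k,\qquad \psi_h\bigl(\mathbb{E}[F\mid\mathcal{G}_k]\bigr)-\psi_h(F)=\psi_h'(F)(-D_kF)+S_k,$$ and have the following properties. (i) If $h$ is Lipschitz with constant $1$, then $$S_k=(D_kF)^2\int_0^1(1-u)\,\psi_h''\bigl(u\,\mathbb{E}[F\mid\mathcal{G}_k]+(1-u)F\bigr)\,du,\qquad R_k=(D_kF)^2\int_0^1(1-u)\,\psi_h''\bigl(uF+(1-u)\mathbb{E}[F\mid\mathcal{G}_k]\bigr)\,du,$$ and $\max(|R_k|,|S_k|)\leq\min\bigl((D_kF)^2,\,2|D_kF|\bigr)$ for all $k\in\mathbb{N}$. (ii) If $h=h_z=\mathbf{1}_{(-\infty,z]}$ for some $z\in\mathbb{R}$ (and $\psi_z:=\psi_{h_z}$), then for all $k\in\mathbb{N}$ $$\max(|R_k|,|S_k|)\leq2|D_kF|\qquad\text{and}\qquad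 S_k=\int_0^{D_kF}\Bigl(\psi_z'(F)-\psi_z'\bigl(\mathbb{E}[F\mid\mathcal{G}_k]+t\bigr)\Bigr)dt.$$
   Context: Let $\mathbb{X}=(X_n)_{n\in\mathbb{N}}$ be a sequence of independent random variables on a probability space $(\Omega,\mathcal{A},\mathbb{P})$, $X_n$ taking values in an arbitrary measurable space; $\mathcal{F}=\sigma(\mathbb{X})$, $\mathcal{G}_k=\sigma(X_j:j\neq k)$, $L^r_{\mathbb{X}}=L^r(\Omega,\mathcal{F},\mathbb{P})$. For $F\in L^1_{\mathbb{X}}$, $D_kF:=F-\mathbb{E}[F\mid\mathcal{G}_k]$. Stein solution: let $Z\sim N(0,1)$ and let $h$ be Borel-measurable with $\mathbb{E}|h(Z)|<\infty$. Define $$\psi_h(x)=e^{x^2/2}\int_{-\infty}^x\bigl(h(t)-\mathbb{E}[h(Z)]\bigr)e^{-t^2/2}\,dt,$$ which solves $\psi'(x)-x\psi(x)=h(x)-\mathbb{E}[h(Z)]$ at all its points of differentiability. At the remaining points one defines $\psi_h'(x):=x\psi_h(x)+h(x)-\mathbb{E}[h(Z)]$, so that this equation holds for $\psi_h'$ at every $x\in\mathbb{R}$. If $h$ is $1$-Lipschitz, $\psi_h\in C^1(\mathbb{R})$ and $\psi_h'$ is Lipschitz; $\psi_h''$ denotes its Lebesgue-a.e. existing derivative. *)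

(* Defs.v *)
From HB Require Import structures.
From mathcomp Require Import all_boot all_order all_algebra.
From mathcomp Require Import finmap.
From mathcomp Require Import all_classical all_reals all_analysis.

Set Implicit Arguments.
Unset Strict Implicit.
Unset Printing Implicit Defensive.

Import Order.TTheory GRing.Theory Num.Theory.
Import numFieldNormedType.Exports.

Local Open Scope classical_set_scope.
Local Open Scope ring_scope.

Section conditional_expectation.
Context (d : measure_display) (Omega : measurableType d) (R : realType).
Variable P : probability Omega R.

(* L^r(Omega, G, P) for a sub-sigma-algebra G; elements are G-measurable
   representatives, not classes modulo a.s. equality. *)
Definition Lspace_sub (G : set (set Omega)) (r : \bar R) (Y : Omega -> R) : Prop :=
  preimage_set_system setT Y measurable `<=` G /\ Y \in Lfun P r.

Definition is_cond_exp (G : set (set Omega)) (F Y : Omega -> R) : Prop :=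
  Lspace_sub G 1%E Y /\
  forall A : set Omega, G A ->
    (\int[P]_(w in A) (Y w)%:E = \int[P]_(w in A) (F w)%:E)%E.

(* A version of E[F | G], picked by choice.  The default value 0 is only reached
   when F has no conditional expectation, e.g. when F is not integrable. *)
Definition cond_exp (G : set (set Omega)) (F : Omega -> R) : Omega -> R :=
  xget (cst 0) [set Y | is_cond_exp G F Y].

Variables (dT : nat -> measure_display) (T : forall n, measurableType (dT n)).
Variable X : forall n, {RV P >-> T n}.

Definition mutually_independent : Prop :=
  forall (J : {fset nat}) (A : forall n, set (T n)),
    (forall n, measurable (A n)) ->
    P (\bigcap_(n in [set` J]) (X n @^-1` A n)) =
    (\prod_(n <- J) P (X n @^-1` A n))%E.

Definition sigma_generated (J : set nat) : set (set Omega) :=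
  <<s \bigcup_(n in J) preimage_set_system setT (X n) measurable >>.

Definition L_X (r : \bar R) (F : Omega -> R) : Prop :=
  Lspace_sub (sigma_generated setT) r F.

Definition sigma_except (k : nat) : set (set Omega) :=
  sigma_generated [set n | n != k].

Definition D_op (k : nat) (F : Omega -> R) : Omega -> R :=
  fun w => F w - cond_exp (sigma_except k) F w.

End conditional_expectation.

Section stein_solution.
Context (R : realType).
Implicit Types (h f : R -> R) (a b x z : R).

Definition gauss_mean h : R := \int[normal_prob 0 1]_x h x.

Definition stein_sol h x : R :=
  expR (x ^+ 2 / 2) *
  \int[lebesgue_measure]_(t in `]-oo, x]) ((h t - gauss_mean h) * expR (- t ^+ 2 / 2)).

Definition stein_sol' h x : R :=
  if `[< derivable (stein_sol h) x 1 >] then derive1 (stein_sol h) x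
  else x * stein_sol h x + h x - gauss_mean h.

(* derive1 is total: at the points where stein_sol' h is not differentiable
   the value is unspecified. *)
Definition stein_sol'' h : R -> R := derive1 (stein_sol' h).

Definition half_line z : R -> R := \1_(`]-oo, z]%classic).

Definition oriented_integral a b f : R :=
  if a <= b then \int[lebesgue_measure]_(t in `[a, b]) f t
  else - \int[lebesgue_measure]_(t in `[b, a]) f t.

End stein_solution.

(* Main.v *)
Require Import Defs.
From HB Require Import structures.
From mathcomp Require Import all_boot all_order all_algebra.
From mathcomp Require Import finmap.
From mathcomp Require Import all_classical all_reals all_analysis.
From mathcomp Require Import measurable_realfun.
From mathcomp Require Import ring lra.

Set Implicit Arguments.
Unset Strict Implicit.
Unset Printing Implicit Defensive.

Import Order.TTheory GRing.Theory Num.Theory.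
Import numFieldNormedType.Exports.

Local Open Scope classical_set_scope.
Local Open Scope ring_scope.

(** The two defining relations for [Rk] and [Sk] give, pointwise,
    [psi (F) - psi (EF) = psi' (F) DF - Sk] and
    [psi (F) = psi (EF) + psi' (EF) DF + Rk].  Taking conditional expectations
    in the second one, [psi (EF)] is left unchanged and [psi' (EF) DF]
    disappears, because the bounded factor [psi' (EF)] is measurable for [G_k]
    and [E[DF | G_k] = 0].  Hence [E[psi (F) | G_k] = psi (EF) + E[Rk | G_k]]
    almost surely, and subtracting this from [psi (F)] gives the expansion
    ([expansion_D_op]).  Conditional expectations with respect to a generated
    sub-sigma-algebra come from the Radon-Nikodym theorem
    ([cond_exp_exists]), and the factor is pulled out by approximating it with
    step functions ([cond_exp_pull_out]).

    All the rest is about [psi].  With [I] the total Gaussian mass, and [G] and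
    [U] the masses of the two half-lines cut at [x], the number
    [psi x * gw x * I] is [a U - b G], where [a] and [b] are the Gaussian
    integrals of [h - h x] over the two half-lines ([stein_sol_tails]); a
    similar formula holds for [psi'].  If [h] is 1-Lipschitz, then [`|a|] and
    [`|b|] are at most the integrals of [`|t - x|], and inequalities on the
    Mills ratio [U / gw] turn this into [`|psi'| <= 1] and
    [`|psi + x psi'| <= 1].  By the Stein equation [psi'] is the sum of
    [x psi x], whose derivative is [psi + x psi'], of [h] and of a constant, so
    [psi'] is 2-Lipschitz.  If [h] is the
    indicator of a half-line, [psi] is explicit on either side of [z], and is
    1-Lipschitz with [`|psi'| <= 1].

    The bounds on the remainders follow: [2 `|DF|] from the two bounds by 1,
    and [DF ^+ 2] from Taylor's formula, since [psi'] is 2-Lipschitz.  The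
    integral forms of the remainders are instances of one fact
    ([lipschitz_FTC]): a Lipschitz function is the integral of any function
    that agrees with its derivative wherever this derivative exists.  The
    function [psi''] is such a function for [psi'] in case (i), and [psi'] is
    one for [psi] in case (ii), including at the kink. *)

(** * Integrals of functions that agree off a null set *)

Section integral_off_null_set.
Local Open Scope ereal_scope.
Import HBNNSimple.
Context d (T : measurableType d) (R : realType).
Variable mu : {measure set T -> \bar R}.

Let nnsfun_sup (f : T -> \bar R) := ereal_sup [set sintegral mu h |
  h in [set h : {nnsfun T >-> R} | forall x, (h x)%:E <= f x]].

Lemma nnsfun_sup_le_off_null (N : set T) (f g : T -> \bar R) :
  measurable N -> mu N = 0 -> (forall x, 0 <= g x) ->
  (forall x, ~ N x -> f x <= g x) -> nnsfun_sup f <= nnsfun_sup g.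
Proof.
move=> mN muN0 g0 fg; apply: ge_ereal_sup => _ [h /= hf <-].
have mNC : measurable (~` N) by exact: measurableC.
pose k := proj_nnsfun h mNC.
have kN x : N x -> k x = 0%R.
  by move=> Nx; rewrite /k -mrestrict /patch memNset//; exact.
have kNC x : ~ N x -> k x = h x.
  by move=> Nx; rewrite /k -mrestrict /patch mem_set.
have kg x : (k x)%:E <= g x.
  have [/kN ->//|Nx] := pselect (N x).
  by rewrite kNC// (le_trans (hf x)) ?fg.
apply: ereal_sup_ubound; exists k => //.
rewrite /sintegral; apply: eq_fsbigr => r _.
have [->|r0] := eqVneq r 0%R; first by rewrite !mul0e.
congr (_ * _).
have -> : k @^-1` [set r] = (h @^-1` [set r]) `\` N.
  apply/seteqP; split => x.
    move=> kx; have {}kx : k x = r by exact: kx.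
    have [Nx|Nx] := pselect (N x).
      by move: kx; rewrite kN// => /esym/eqP; rewrite (negbTE r0).
    by split => //; rewrite /preimage/= -kNC.
  by move=> [hx Nx]; have : k x = r by rewrite kNC.
rewrite [RHS](measureDI mu _ mN)// [X in _ + X](_ : _ = 0) ?adde0//.
by apply: (subset_measure0 _ mN _ muN0); [exact: measurableI|exact: subIsetr].
Qed.

(** A simple function below [f] can be set to zero on a null set at no cost, so
    the supremum that defines the integral does not see what [f] does there,
    even when [f] is not measurable.  This is used for derivatives, whose values
    at the points of non-differentiability are arbitrary. *)
Lemma eq_integral_off_null (N D : set T) (f g : T -> \bar R) :
  measurable N -> mu N = 0 -> (forall x, D x -> ~ N x -> f x = g x) ->
  \int[mu]_(x in D) f x = \int[mu]_(x in D) g x.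
Proof.
move=> mN muN0 fg.
have fgD x : ~ N x -> (f \_ D) x = (g \_ D) x.
  move=> Nx; rewrite /patch; case: ifPn => // /set_mem Dx.
  exact: fg.
rewrite /integral; congr (_ - _); apply/eqP; rewrite eq_le; apply/andP; split;
  apply: (nnsfun_sup_le_off_null mN muN0) => x; rewrite ?funepos_ge0 ?funeneg_ge0//;
  by move=> Nx; rewrite ?(funeposE,funenegE) fgD.
Qed.

End integral_off_null_set.

(** * The fundamental theorem of calculus for Lipschitz functions *)

Section lebesgue_stieltjes_density.
Context (R : realType).
Local Notation mu := (@lebesgue_measure R).

(** Both measures are infima over the same countable covers by half-open
    intervals, on which the inequality is the hypothesis. *)
Lemma stieltjes_le_lebesgue (f : cumulative R R) (K : R) (A : set R) :
  0 < K -> (forall x y, x <= y -> f y - f x <= K * (y - x)) ->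
  (lebesgue_stieltjes_measure f A <= K%:E * mu A)%E.
Proof.
move=> K0 fK; rewrite /lebesgue_measure /lebesgue_stieltjes_measure.
rewrite /measure_extension /mu_ext -ereal_inf_pZl//.
apply: le_ereal_inf_tmp => _ [_ [C coverC <-] <-].
apply: (@le_trans _ _ (\sum_(k <oo) wlength f (C k))%E).
  by apply: ereal_inf_lbound; exists C.
rewrite -nneseriesZl; last by move=> i _; exact: wlength_ge0.
apply: lee_nneseries => [i _ _|i _]; first exact: wlength_ge0.
have /ocitvP[->|[[x y] /= xy ->]] := cover_measurable coverC i.
  by rewrite [X in (X <= _)%E]wlength0 [X in (_ <= _ * X)%E]wlength0 mule0.
rewrite [X in (X <= _)%E]wlength_itv_bnd ?(ltW xy)//.
rewrite [X in (_ * X)%E]wlength_itv_bnd ?(ltW xy)//.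
by rewrite -EFinM lee_fin fK// ltW.
Qed.

(** The density is a Radon-Nikodym derivative.  The Stieltjes measure of [f] is
    first restricted to [`]a, b]], which makes it finite. *)
Lemma lipschitz_cumulative_density (f : cumulative R R) (K a b : R) :
  0 < K -> a <= b -> (forall x y, x <= y -> f y - f x <= K * (y - x)) ->
  exists p : R -> R, mu.-integrable [set: R] (EFin \o p) /\
    forall x y, a <= x -> x <= y -> y <= b ->
      \int[mu]_(t in `]x, y]) p t = f y - f x.
Proof.
move=> K0 ab fK.
have LSE x y : x <= y ->
    lebesgue_stieltjes_measure f `]x, y]%classic = (f y - f x)%:E.
  move=> xy; rewrite /lebesgue_stieltjes_measure /measure_extension.
  rewrite measurable_mu_extE/= ?wlength_itv_bnd//.
  exact: is_ocitv.
have ab_fin : (lebesgue_stieltjes_measure f `]a, b]%classic < +oo)%E.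
  by rewrite LSE// ltry.
have mab : measurable (`]a, b]%classic : set R) by [].
pose nu : {finite_measure set (measurableTypeR R) -> \bar R} :=
  mfrestr (f := lebesgue_stieltjes_measure f) mab ab_fin.
have numu : charge_of_finite_measure nu `<< mu.
  apply/null_content_dominatesP => A mA muA0.
  apply/eqP; rewrite eq_le measure_ge0 andbT.
  apply: (@le_trans _ _ (lebesgue_stieltjes_measure f A)).
    by apply: (measureIl (lebesgue_stieltjes_measure f)).
  rewrite (le_trans (stieltjes_le_lebesgue A K0 fK))//.
  by rewrite [mu A]muA0 mule0.
pose q := Radon_Nikodym (charge_of_finite_measure nu) mu.
have iq : mu.-integrable setT q by exact: Radon_Nikodym_integrable.
have qE : EFin \o (fine \o q) = q.
  by apply/funext => x /=; rewrite fineK//; exact: Radon_Nikodym_fin_num.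
exists (fine \o q); rewrite qE; split => // x y ax xy yb.
rewrite /Rintegral; under eq_integral do
  rewrite /= fineK ?Radon_Nikodym_fin_num//.
rewrite -Radon_Nikodym_integral//=.
rewrite /charge_of_finite_measure/= /mfrestr /mrestr/=.
rewrite setIidl ?LSE//.
by apply: subset_itv; rewrite bnd_simp.
Qed.
End lebesgue_stieltjes_density.

Section lipschitz_FTC.
Context (R : realType).
Local Notation mu := (@lebesgue_measure R).

(** Adding [L * t] makes [H] nondecreasing, hence the primitive of a density;
    by Lebesgue's differentiation theorem [H] is differentiable almost
    everywhere, with this density minus [L] as its derivative, so that [g]
    agrees with it off a null set. *)
Lemma lipschitz_FTC (H g : R -> R) (L a b : R) : a <= b -> 0 <= L ->
  (forall x y, a <= x -> x <= y -> y <= b -> `|H y - H x| <= L * (y - x)) ->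
  (forall x, a < x -> x < b -> derivable H x 1 -> derive1 H x = g x) ->
  \int[mu]_(t in `[a, b]) g t = H b - H a.
Proof.
move=> ab L0 HL Hg.
(* [c] clamps to [a, b], in order to extend [H] to a function on the whole
   line that is constant outside of the interval. *)
pose c x := Num.max a (Num.min b x).
have cab x : a <= c x <= b.
  rewrite /c le_max lexx/= ge_max ab ge_min lexx//.
have c_id x : a <= x -> x <= b -> c x = x.
  by move=> ax xb; rewrite /c min_r// max_r.
have c_mono x y : x <= y -> c x <= c y.
  move=> xy; rewrite /c ge_max !le_max lexx/=; apply/orP; right.
  by rewrite le_min ge_min lexx/= ge_min xy orbT.
have c_lip x y : x <= y -> c y - c x <= y - x.
  move=> xy; rewrite /c.
  by case: (leP b x) => bx; case: (leP b y) => yb; rewrite ?(max_r ab);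
    case: (leP a x) => ax; case: (leP a y) => ay; lra.
pose G x := H (c x) + L * c x.
(* The summand 1 only makes the constant positive. *)
have GB x y : x <= y -> 0 <= G y - G x <= (L *+ 2 + 1) * (y - x).
  move=> xy; have /andP[acx _] := cab x; have /andP[_ cyb] := cab y.
  have := HL _ _ acx (c_mono _ _ xy) cyb; rewrite ler_norml => /andP[HL1 HL2].
  have cc := c_lip _ _ xy.
  rewrite /G; apply/andP; split; first by lra.
  have : L * (c y - c x) <= L * (y - x) by exact: ler_wpM2l.
  by rewrite mulr2n; nra.
have G_nd : nondecreasing G.
  by move=> x y xy; have /andP[] := GB _ _ xy; rewrite subr_ge0.
have G_cont : continuous G.
  have d0 : 0 < L *+ 2 + 1 by rewrite mulr2n; lra.
  move=> x; apply/cvgrPdist_le => e e0; near=> y.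
  have : `|x - y| <= e / (L *+ 2 + 1).
    near: y; exists (e / (L *+ 2 + 1)) => /=; first exact: divr_gt0.
    by move=> y /= /ltW.
  rewrite ler_pdivlMr// => /(le_trans _); apply.
  rewrite mulrC; case: (leP x y) => [xy|/ltW yx].
    have /andP[? ?] := GB _ _ xy.
    by rewrite distrC ger0_norm// distrC ger0_norm ?subr_ge0.
  have /andP[? ?] := GB _ _ yx.
  by rewrite !ger0_norm ?subr_ge0// -subr_ge0.
pose Gm := isCumulative.Build R _ R G G_nd (right_continuousW G_cont).
pose GC : cumulative R R := HB.pack G Gm.
have [|//|p [ip pG]] := @lipschitz_cumulative_density R GC (L *+ 2 + 1) a b _ ab.
- by rewrite mulr2n; lra.
- by move=> x y xy; have /andP[] := GB _ _ xy.
pose F x := \int[mu]_(t in `]-oo, x]) p t.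
have ipy (i : interval R) : mu.-integrable [set` i] (EFin \o p).
  exact: (integrableS measurableT _ _ ip).
have FG x y : a <= x -> x <= y -> y <= b -> F y - F x = G y - G x.
  move=> ax xy yb; rewrite -[RHS]pG// /F.
  by rewrite Rintegral_itvB//; exact: ipy.
have /FTC1Ny : forall y, mu.-integrable `]-oo, y] (EFin \o p) by move=> y.
move=> /(_ (open_integrable_locally openT ip)) [N [mN muN0 FN]].
have derH x : a < x -> x < b -> ~ N x -> is_derive x 1 H (p x - L).
  move=> ax xb Nx.
  have [dF F'] : derivable F x 1 /\ derive1 F x = p x.
    by apply: contrapT => nF; apply: Nx; exact: FN.
  have isF : is_derive x 1 F (p x) by rewrite -F' derive1E; exact: derivableP.
  pose K y := F y - L * y + (G a - F a).
  have isK : is_derive x 1 K (p x - L).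
    by apply: is_derive_eq; rewrite addr0 [L%:A]mulr1.
  apply: near_eq_is_derive isK; near=> y.
  have ay : a <= y by apply: ltW; near: y; exact: lt_nbhsr.
  have yb : y <= b by apply: ltW; near: y; exact: lt_nbhsl.
  have GE : G y = H y + L * y by rewrite /G c_id.
  by have := FG _ _ (lexx a) ay yb; rewrite /K GE => ?; lra.
have -> : \int[mu]_(t in `[a, b]) g t = \int[mu]_(t in `[a, b]) (p t - L).
  congr fine; apply: (@eq_integral_off_null _ _ _ mu (N `|` [set a; b])).
  - by apply: measurableU => //; apply: measurableU.
  - apply/eqP; rewrite -measure_le0; apply: (le_trans (measureU2 _ _ _)) => //.
      by apply: measurableU.
    rewrite [X in (X + _)%E]muN0 add0e (le_trans (measureU2 _ _ _))//.
    rewrite [X in (X + _)%E](lebesgue_measure_set1 a).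
    by rewrite [X in (_ + X)%E](lebesgue_measure_set1 b) adde0.
  - move=> x /=; rewrite in_itv/= => /andP[ax xb] Nx; congr EFin.
    have {}ax : a < x.
      by rewrite lt_neqAle ax andbT; apply/eqP => xa; apply: Nx; right; left.
    have {}xb : x < b.
      by rewrite lt_neqAle xb andbT; apply/eqP => xa; apply: Nx; right; right.
    have Hx : is_derive x 1 H (p x - L).
      by apply: derH => // Nx'; apply: Nx; left.
    by rewrite -Hg//; rewrite derive1E derive_val.
rewrite RintegralB//; last first.
  apply: (@continuous_compact_integrable R (cst L)).
    exact: segment_compact.
  by apply: continuous_subspaceT => x; exact: cvg_cst.
have lab : mu (`[a, b]%classic : set R) = (b - a)%:E.
  rewrite lebesgue_measure_itv/= lte_fin.
  by move: ab; rewrite le_eqVlt => /predU1P[->|->]; rewrite ?ltxx ?subrr.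
rewrite Rintegral_cst// [X in _ * fine X]lab -(Rintegral_itv_obnd_cbnd (ipy _)).
by rewrite pG//= /G !c_id//=; lra.
Unshelve. all: by end_near. Qed.

End lipschitz_FTC.

(** * Conditional expectation given a generated sub-sigma-algebra *)

Lemma le_integrable_real d (T : measurableType d) (R : realType)
    (mu : {measure set T -> \bar R}) (D : set T) (f g : T -> R) :
  measurable D -> measurable_fun D f -> (forall x, D x -> `|f x| <= g x) ->
  mu.-integrable D (EFin \o g) -> mu.-integrable D (EFin \o f).
Proof.
move=> mD mf fg; apply: le_integrable => //; first exact/measurable_EFinP.
by move=> x Dx /=; rewrite lee_fin (le_trans (fg x Dx))// ler_norm.
Qed.

Section conditional_expectation_theory.
Context d (Omega : measurableType d) (R : realType) (P : probability Omega R).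
Variable GG : set (set Omega).
Hypothesis GG_measurable : GG `<=` measurable.
Local Notation G := <<s GG >>.
Local Notation OG := (g_sigma_algebraType GG).

Lemma sub_sigma_measurable (A : set Omega) : G A -> measurable A.
Proof.
by apply: smallest_sub => //; exact: sigma_algebra_measurable.
Qed.

Lemma sub_sigma_measurable_funP (Y : Omega -> R) :
  preimage_set_system setT Y measurable `<=` G <->
  measurable_fun [set: OG] (Y : OG -> R).
Proof.
split=> [YG _ B mB|mY _ [B mB <-]]; last exact: mY.
by apply: YG; exists B.
Qed.

Let incl : Omega -> OG := id.

Lemma measurable_sub_sigma_id : measurable_fun [set: Omega] incl.
Proof. by move=> _ B mB; rewrite setTI; exact: sub_sigma_measurable. Qed.
Let mincl := measurable_sub_sigma_id.

Lemma sub_sigma_measurable_fun (Y : Omega -> R) :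
  measurable_fun [set: OG] (Y : OG -> R) -> measurable_fun [set: Omega] Y.
Proof. by move=> mY; apply: (measurableT_comp mY mincl). Qed.

HB.instance Definition _ := isMeasurableFun.Build _ _ _ _ incl mincl.

(* Seeing the restriction of [P] to [G] as an image measure makes the change of
   variables for integrals available. *)
Let PG : probability OG R := distribution P incl.

Lemma integral_sub_sigma (Y : Omega -> R) (A : set Omega) :
  measurable_fun [set: OG] (Y : OG -> R) -> P.-integrable setT (EFin \o Y) ->
  G A -> (\int[PG]_(w in A) (Y w)%:E = \int[P]_(w in A) (Y w)%:E)%E.
Proof.
move=> mY iY GA; rewrite (integral_pushforward mincl)//.
- exact/measurable_EFinP.
- apply: (integrableS measurableT) iY => //.
  exact: sub_sigma_measurable.
Qed.

(** The conditional expectation is the Radon-Nikodym derivative, on the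
    sub-sigma-algebra, of the charge [A |-> \int_A F] with respect to [P]. *)
Lemma cond_exp_exists (F : Omega -> R) :
  P.-integrable setT (EFin \o F) -> exists Y, is_cond_exp P G F Y.
Proof.
move=> iF.
pose nu' : {charge set OG -> \bar R} := pushforward (induced_charge iF) incl.
pose nu := nu' mincl.
have nuPG : nu `<< PG.
  apply/null_content_dominatesP => A mA PA0.
  apply: null_set_integral => //; first exact: sub_sigma_measurable.
  exact/measurable_funTS/(measurable_int _ iF).
pose q := Radon_Nikodym nu PG.
have iq : PG.-integrable setT q by exact: Radon_Nikodym_integrable.
have qE : EFin \o (fine \o q) = q.
  by apply/funext => x /=; rewrite fineK//; exact: Radon_Nikodym_fin_num.
have mq : measurable_fun [set: OG] (fine \o q).
  by apply/measurable_EFinP; rewrite qE; exact: measurable_int iq.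
have iPq : P.-integrable setT (EFin \o (fine \o q)).
  apply/integrableP; split.
    by apply/measurable_EFinP; exact: sub_sigma_measurable_fun.
  move/integrableP : (iq) => [_ qoo].
  rewrite qE (_ : (\int[P]_x _)%E = (\int[PG]_x `|q x|)%E)//.
  rewrite (ge0_integral_pushforward mincl)//.
  by apply: measurableT_comp => //; exact: measurable_int iq.
exists (fine \o q); split; first split.
- exact/sub_sigma_measurable_funP.
- exact/Lfun1_integrable.
- move=> A GA; rewrite -integral_sub_sigma//.
  transitivity (nu A); last by [].
  rewrite (Radon_Nikodym_integral nuPG)//.
  by apply: eq_integral => w _; rewrite /= fineK// Radon_Nikodym_fin_num.
Qed.

(** Two versions have the same integrals over all events of the
    sub-sigma-algebra, so they agree almost everywhere for the restriction of
    [P]; a null event of [G] is a null event. *)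
Lemma cond_exp_unique (F Y1 Y2 : Omega -> R) :
  is_cond_exp P G F Y1 -> is_cond_exp P G F Y2 ->
  {ae P, forall w, Y1 w = Y2 w}.
Proof.
move=> [[/sub_sigma_measurable_funP mY1 /Lfun1_integrable iY1] Y1E].
move=> [[/sub_sigma_measurable_funP mY2 /Lfun1_integrable iY2] Y2E].
have : ae_eq PG setT (EFin \o Y1) (EFin \o Y2).
  apply: integral_ae_eq => //.
  - apply: (integrable_pushforward mincl) => //.
    exact/measurable_EFinP.
  - exact/measurable_EFinP.
  - by move=> A _ mA; rewrite !integral_sub_sigma// Y1E// Y2E.
move=> [N [mN PN0 YN]]; exists N; split => //; first exact: sub_sigma_measurable.
by move=> w /= Yw; apply: YN => /= Yw'; apply: Yw; case: (Yw' I).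
Qed.

Lemma cond_exp_spec (F : Omega -> R) :
  P.-integrable setT (EFin \o F) -> is_cond_exp P G F (cond_exp P G F).
Proof.
by move=> /cond_exp_exists; exact: xgetPex.
Qed.

Lemma cond_exp_measurable (Y : Omega -> R) :
  measurable_fun [set: OG] (Y : OG -> R) -> P.-integrable setT (EFin \o Y) ->
  is_cond_exp P G Y Y.
Proof.
by move=> mY iY; split => //; split;
  [exact/sub_sigma_measurable_funP|exact/Lfun1_integrable].
Qed.

Lemma cond_expD (F1 F2 Y1 Y2 : Omega -> R) :
  P.-integrable setT (EFin \o F1) -> P.-integrable setT (EFin \o F2) ->
  is_cond_exp P G F1 Y1 -> is_cond_exp P G F2 Y2 ->
  is_cond_exp P G (F1 \+ F2) (Y1 \+ Y2).
Proof.
move=> iF1 iF2 [[/sub_sigma_measurable_funP mY1 /Lfun1_integrable iY1] Y1E].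
move=> [[/sub_sigma_measurable_funP mY2 /Lfun1_integrable iY2] Y2E].
split; first split.
- exact/sub_sigma_measurable_funP/measurable_funD.
- by apply/Lfun1_integrable; exact: (integrableD measurableT iY1 iY2).
- move=> A GA; have mA := sub_sigma_measurable GA.
  have sub f : P.-integrable setT f -> P.-integrable A f.
    by move=> ?; exact: (integrableS measurableT).
  by rewrite !integralD_EFin//; [rewrite Y1E// Y2E|exact: sub..].
Qed.

End conditional_expectation_theory.

Section pull_out.
Context d (Omega : measurableType d) (R : realType) (P : probability Omega R).
Variable GG : set (set Omega).
Hypothesis GG_measurable : GG `<=` measurable.
Local Notation G := <<s GG >>.
Local Notation OG := (g_sigma_algebraType GG).
Variable W : Omega -> R.
Hypothesis iW : P.-integrable setT (EFin \o W).
Hypothesis W0 : (forall A, G A -> \int[P]_(w in A) (W w)%:E = 0)%E.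

Let mW : measurable_fun [set: Omega] W.
Proof. exact/measurable_EFinP/(measurable_int _ iW). Qed.

Let indic_pull_out (A : set Omega) : G A ->
  P.-integrable setT (EFin \o (fun w => \1_A w * W w)) /\
  \int[P]_w (\1_A w * W w) = 0.
Proof.
move=> GA; have mA := sub_sigma_measurable GG_measurable GA; split.
  apply: (le_integrable_real (g := fun w => `|W w|)) => //.
  - by apply: measurable_funM => //; exact: measurable_indic.
  - move=> w _; rewrite normrM ler_piMl// indicE.
    by case: (_ \in _); rewrite ?normr1 ?normr0.
  - exact: integrable_norm.
transitivity (fine (\int[P]_(w in A) (W w)%:E)%E); last by rewrite W0.
rewrite [in RHS]integral_mkcond.
congr fine; apply: eq_integral => w _.
by rewrite /patch indicE; case: ifPn; rewrite ?mul1r ?mul0r.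
Qed.

Let step_pull_out (I : Type) (s : seq I) (A : I -> set Omega) (c : I -> R) :
  (forall i, G (A i)) ->
  P.-integrable setT (EFin \o (fun w => (\sum_(i <- s) c i * \1_(A i) w) * W w)) /\
  \int[P]_w ((\sum_(i <- s) c i * \1_(A i) w) * W w) = 0.
Proof.
move=> GA; elim: s => [|i s [IHi IH0]].
  have -> : (fun w => (\sum_(i <- [::]) c i * \1_(A i) w) * W w) = cst 0.
    by apply/funext => w; rewrite big_nil mul0r.
  by split; [exact: integrable0|rewrite /Rintegral integral0].
have [Ai A0] := indic_pull_out (GA i).
have E : (fun w => (\sum_(j <- i :: s) c j * \1_(A j) w) * W w) =
    (fun w => c i * (\1_(A i) w * W w) +
              (\sum_(j <- s) c j * \1_(A j) w) * W w).
  by apply/funext => w; rewrite big_cons mulrDl mulrA.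
have ci : P.-integrable setT (EFin \o (fun w => c i * (\1_(A i) w * W w))).
  exact: (integrableZl measurableT (c i) Ai).
rewrite E; split; first exact: (integrableD measurableT ci IHi).
by rewrite RintegralD// RintegralZl// A0 IH0 mulr0 addr0.
Qed.

(* [Z] lies within [1 / c] of the step function [Zn], whose product with [W]
   integrates to zero; hence the integral of [Z * W] is at most [1 / c] times
   that of [`|W|], and [c] is chosen so that this is at most [e]. *)
Let unit_pull_out (Z : Omega -> R) :
  measurable_fun [set: OG] (Z : OG -> R) -> (forall w, 0 <= Z w < 1) ->
  P.-integrable setT (EFin \o (fun w => Z w * W w)) /\
  \int[P]_w (Z w * W w) = 0.
Proof.
move=> mGZ Z01; have mZ := sub_sigma_measurable_fun GG_measurable mGZ.
have iZW : P.-integrable setT (EFin \o (fun w => Z w * W w)).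
  apply: (le_integrable_real (g := fun w => `|W w|)) => //.
  - exact: measurable_funM.
  - move=> w _; have /andP[Z0 Z1] := Z01 w.
    by rewrite normrM ler_piMl// ger0_norm// ltW.
  - exact: integrable_norm.
split => //; apply/eqP; rewrite -normr_le0; apply/ler_addgt0Pr => e e0.
rewrite add0r.
set K := \int[P]_w `|W w|.
have K0 : 0 <= K by exact: Rintegral_ge0.
pose n := Num.truncn (K / e); pose c : R := n.+1%:R.
have c0 : 0 < c by rewrite ltr0n.
have KcE : K <= c * e.
  by rewrite -ler_pdivrMr// ltW// /c truncnS_gt// divr_ge0// ltW.
pose A (i : 'I_n.+1) := Z @^-1` `[i%:R / c, i.+1%:R / c[%classic.
have GA i : G (A i).
  by rewrite -[A i]setTI; apply: mGZ.
pose Zn w := \sum_(i < n.+1) (i%:R / c) * \1_(A i) w.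
have [iZn Zn0] := step_pull_out (index_enum 'I_n.+1) (fun i => i%:R / c) GA.
have ZZn w : `|Z w - Zn w| <= c^-1.
  have /andP[Z0 Z1] := Z01 w.
  have cZ0 : 0 <= Z w * c by rewrite mulr_ge0// ltW.
  have /andP[t1 t2] := truncn_itv cZ0.
  have jn : (Num.truncn (Z w * c) < n.+1)%N.
    by rewrite -(ltr_nat R) (le_lt_trans t1)// -/c gtr_pMl.
  pose j := Ordinal jn.
  have Aj i : \1_(A i) w = (i == j)%:R :> R.
    rewrite indicE; congr ((nat_of_bool _)%:R); apply/idP/idP.
      rewrite inE /A/= in_itv/= ler_pdivrMr// ltr_pdivlMr// => /andP[i1 i2].
      rewrite -val_eqE/= eqn_leq -ltnS -(ltr_nat R) (le_lt_trans i1 t2)/=.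
      by rewrite -ltnS -(ltr_nat R) (le_lt_trans t1 i2).
    move=> /eqP ->; rewrite inE /A/= in_itv/= ler_pdivrMr// ltr_pdivlMr//.
    by rewrite t1 t2.
  have -> : Zn w = j%:R / c.
    rewrite /Zn (bigD1 j)//= Aj eqxx mulr1 big1 ?addr0// => i ij.
    by rewrite Aj (negbTE ij) mulr0.
  have jc : j%:R / c <= Z w by rewrite ler_pdivrMr.
  rewrite ger0_norm ?subr_ge0// lerBlDl -{2}[c^-1]mul1r -mulrDl natr1.
  by rewrite ler_pdivlMr// ltW.
have -> : \int[P]_w (Z w * W w) = \int[P]_w (Z w * W w - Zn w * W w).
  by rewrite RintegralB// Zn0 subr0.
have iD : P.-integrable setT (EFin \o (fun w => Z w * W w - Zn w * W w)).
  exact: (integrableB measurableT iZW iZn).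
rewrite (le_trans (le_normr_Rintegral _ iD))//.
apply: (@le_trans _ _ (\int[P]_w (c^-1 * `|W w|))).
  apply: le_Rintegral => //.
  - exact: (integrable_norm iD).
  - exact: (integrableZl measurableT c^-1 (integrable_norm iW)).
  - by move=> w _; rewrite -mulrBl normrM ler_wpM2r.
rewrite RintegralZl//; last exact: (integrable_norm iW).
by rewrite -/K ler_pdivrMl.
Qed.

(** An affine change of variable brings [Z] between 0 and 1. *)
Lemma integral_pull_out (Z : Omega -> R) (M : R) :
  measurable_fun [set: OG] (Z : OG -> R) -> (forall w, `|Z w| <= M) ->
  P.-integrable setT (EFin \o (fun w => Z w * W w)) /\
  \int[P]_w (Z w * W w) = 0.
Proof.
move=> mZ ZM; pose K := `|M| + 1.
have K0 : 0 < K by rewrite ltr_wpDl.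
pose Z' w := (Z w + K) / (K *+ 2).
have K2 : 0 < K *+ 2 by rewrite mulrn_wgt0.
have Z'01 w : 0 <= Z' w < 1.
  have := le_trans (ZM w) (ler_norm M); rewrite ler_norml => /andP[Z1 Z2].
  rewrite /Z' ltr_pdivrMr// mul1r divr_ge0 ?(ltW K2)//= /K ?mulr2n; lra.
have mZ' : measurable_fun [set: OG] (Z' : OG -> R).
  by apply: measurable_funM => //; exact: measurable_funD.
have [iZ' Z'0] := unit_pull_out mZ' Z'01.
have E : (fun w => Z w * W w) = (fun w => K *+ 2 * (Z' w * W w) - K * W w).
  apply/funext => w; rewrite /Z'; field.
  by rewrite gt_eqF//= gt_eqF.
have i1 : P.-integrable setT (EFin \o (fun w => K *+ 2 * (Z' w * W w))).
  exact: (integrableZl measurableT (K *+ 2) iZ').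
have i2 : P.-integrable setT (EFin \o (fun w => K * W w)).
  exact: (integrableZl measurableT K iW).
rewrite E; split; first exact: (integrableB measurableT i1 i2).
rewrite RintegralB// !RintegralZl// Z'0.
by rewrite /Rintegral W0 ?mulr0 ?subrr//; exact: (@measurableT _ OG).
Qed.

(** Over an event [A] of [G], this is the previous lemma for the factor
    [Z * \1_A]. *)
Lemma cond_exp_pull_out (Z : Omega -> R) (M : R) :
  measurable_fun [set: OG] (Z : OG -> R) -> (forall w, `|Z w| <= M) ->
  is_cond_exp P G (fun w => Z w * W w) (cst 0).
Proof.
move=> mZ ZM; split.
  split; last by apply/Lfun1_integrable; exact: integrable0.
  by apply/sub_sigma_measurable_funP; exact: measurable_cst.
move=> A GA; have mA := sub_sigma_measurable GG_measurable GA.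
rewrite integral0.
pose ZA w := Z w * \1_A w.
have mZA : measurable_fun [set: OG] (ZA : OG -> R).
  by apply: measurable_funM => //; exact: measurable_indic.
have ZAM w : `|ZA w| <= M.
  rewrite (le_trans _ (ZM w))// normrM ler_piMr// indicE.
  by case: (_ \in _); rewrite ?normr1 ?normr0.
have [iZA ZA0] := integral_pull_out mZA ZAM.
rewrite integral_mkcond.
have -> : ((fun w => (Z w * W w)%:E) \_ A) = EFin \o (fun w => ZA w * W w).
  apply/funext => w; rewrite /patch/= /ZA indicE.
  by case: ifPn; rewrite ?mulr1 ?mulr0 ?mul0r.
rewrite -[RHS]fineK; last exact: (integrable_fin_num measurableT iZA).
by rewrite [fine _]ZA0.
Qed.

End pull_out.

(** * The Gaussian weight and its tails *)

Section gaussian_weight.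
Context (R : realType).
Local Notation mu := (@lebesgue_measure R).
Implicit Types (x t : R) (f : R -> R).

Definition gauss_weight x : R := expR (- x ^+ 2 / 2).
Local Notation gw := gauss_weight.

Lemma gauss_weight_gt0 x : 0 < gw x. Proof. exact: expR_gt0. Qed.
Local Hint Resolve gauss_weight_gt0 : core.

Lemma gauss_weight_ge0 x : 0 <= gw x. Proof. exact: ltW. Qed.
Local Hint Resolve gauss_weight_ge0 : core.

Lemma gauss_weightN x : gw (- x) = gw x.
Proof. by rewrite /gw sqrrN. Qed.

Global Instance is_derive_gauss_weight x : is_derive x 1 gw (- x * gw x).
Proof.
have -> : gw = expR \o (fun x => - x ^+ 2 / 2) by [].
apply: is_derive_eq.
by rewrite /GRing.scale/= /gw; field.
Qed.

Lemma continuous_gauss_weight : continuous gw.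
Proof.
move=> x; apply: differentiable_continuous; apply/derivable1_diffP.
by case: (is_derive_gauss_weight x).
Qed.

Lemma measurable_gauss_weight : measurable_fun [set: R] gw.
Proof. by apply: continuous_measurable_fun; exact: continuous_gauss_weight. Qed.

Lemma cvg_gauss_weight : gw x @[x --> +oo] --> 0.
Proof.
apply: (@squeeze_cvgr _ _ _ _ (cst 0) (fun x => expR (- x))).
- near=> x; rewrite /= gauss_weight_ge0 /gw ler_expR mulNr lerN2.
  have : 2 <= x by near: x; exact: nbhs_pinfty_ge.
  by move=> x2; nra.
- exact: cvg_cst.
- exact: cvgr_expR.
Unshelve. all: by end_near. Qed.

(** The integral of the weight, [Num.sqrt (2 * pi)]. *)
Definition gauss_mass : R := (normal_peak 1)^-1.

Lemma gauss_mass_ge2 : 2 <= gauss_mass.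
Proof.
rewrite /gauss_mass /normal_peak invrK -[2]gtr0_norm// -sqrtr_sqr.
rewrite ler_sqrt ?mulrn_wge0 ?mulr_ge0 ?sqr_ge0 ?pi_ge0//.
by rewrite expr1n mul1r; have := pi_ge2 R; lra.
Qed.

Lemma gauss_mass_gt0 : 0 < gauss_mass.
Proof. exact: lt_le_trans gauss_mass_ge2. Qed.
Local Hint Resolve gauss_mass_gt0 : core.

Lemma gauss_weight_le1 x : gw x <= 1.
Proof. by rewrite /gw -expR0 ler_expR mulNr oppr_le0 divr_ge0// sqr_ge0. Qed.

Lemma normal_pdf01E x : normal_pdf 0 1 x = gw x / gauss_mass.
Proof.
rewrite normal_pdfE ?oner_neq0// /normal_fun subr0 expr1n.
by rewrite /gauss_mass invrK mulrC -mulr_natr mul1r.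
Qed.

Lemma gauss_weightE x : gw x = gauss_mass * normal_pdf 0 1 x.
Proof. by rewrite normal_pdf01E mulrC divfK// gt_eqF. Qed.

Lemma integrable_gauss_weight : mu.-integrable setT (EFin \o gw).
Proof.
have -> : EFin \o gw = (fun x => gauss_mass%:E * (normal_pdf 0 1 x)%:E)%E.
  by apply/funext => x /=; rewrite gauss_weightE.
by apply: integrableZl => //; exact: integrable_normal_pdf.
Qed.

Lemma Rintegral_gauss_weight : \int[mu]_x gw x = gauss_mass.
Proof.
under eq_Rintegral do rewrite gauss_weightE.
rewrite RintegralZl//; last exact: integrable_normal_pdf.
by rewrite /Rintegral integral_normal_pdf mulr1.
Qed.

(** The integrand is the derivative of [- L * gw], which vanishes at infinity.
    Choosing [L] yields exact values ([L = 1]) or bounds (rational [L]) for the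
    Gaussian tails. *)
Lemma gauss_tail_FTC (L dL : R -> R) (C x : R) :
  (forall t, x <= t -> is_derive t 1 L (dL t)) ->
  (forall t, x <= t -> {for t, continuous dL}) ->
  (forall t, x <= t -> 0 <= t * L t - dL t) ->
  (forall t, x <= t -> `|L t| <= C) ->
  (\int[mu]_(t in `[x, +oo[) ((t * L t - dL t) * gw t)%:E = (L x * gw x)%:E)%E.
Proof.
move=> DL cL pos LC.
pose F t := - (L t * gw t).
have DF t : x <= t -> is_derive t 1 F ((t * L t - dL t) * gw t).
  move=> xt; have := DL t xt => ?; rewrite /F.
  by apply: is_derive_eq; rewrite /GRing.scale/=; ring.
have cts t : x <= t -> {for t, continuous F}.
  move=> xt; apply: differentiable_continuous; apply/derivable1_diffP.
  by case: (DF t xt).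
rewrite (@ge0_continuous_FTC2y _ _ F x 0).
- by rewrite sub0e /F EFinN oppeK.
- by move=> t xt; rewrite mulr_ge0// pos.
- apply: continuous_in_subspaceT => t; rewrite inE/= in_itv/= andbT => xt.
  apply: cvgM; last exact: continuous_gauss_weight.
  apply: cvgB; last exact: cL.
  apply: cvgM; first exact: cvg_id.
  apply: differentiable_continuous; apply/derivable1_diffP.
  by case: (DL t xt).
- rewrite -oppr0; apply: cvgN.
  apply: (@squeeze_cvgr _ _ _ _ (fun t => - (C * gw t)) (fun t => C * gw t)).
  + near=> t; have xt : x <= t by near: t; apply: nbhs_pinfty_ge; exact: num_real.
    have := LC t xt; rewrite ler_norml => /andP[L1 L2].
    by rewrite -mulNr !ler_wpM2r.
  + rewrite -oppr0 -[X in - X](mulr0 C); apply: cvgN.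
    by apply: cvgM; [exact: cvg_cst|exact: cvg_gauss_weight].
  + rewrite -[X in _ --> X](mulr0 C).
    by apply: cvgM; [exact: cvg_cst|exact: cvg_gauss_weight].
- by move=> t /ltW xt; case: (DF t xt).
- by apply: cvg_at_right_filter; exact: cts.
- move=> t; rewrite in_itv/= andbT => /ltW xt.
  by have := DF t xt => ?; rewrite derive1E derive_val.
Unshelve. all: by end_near. Qed.

End gaussian_weight.

Section gaussian_tails.
Context (R : realType).
Local Notation mu := (@lebesgue_measure R).
Local Notation gw := (@gauss_weight R).
Implicit Types (x t : R) (f : R -> R).

Let gw_gt0 x : 0 < gw x. Proof. exact: gauss_weight_gt0. Qed.
Let gw_ge0 x : 0 <= gw x. Proof. exact: gauss_weight_ge0. Qed.

Definition upper_tail f x := \int[mu]_(t in `[x, +oo[) (f t * gw t).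
Definition lower_tail f x := \int[mu]_(t in `]-oo, x]) (f t * gw t).

(** A class that contains the Lipschitz functions and the indicators, and whose
    members are integrable against the Gaussian weight. *)
Definition affine_growth f :=
  measurable_fun [set: R] f /\ exists A B : R, forall t, `|f t| <= A + B * `|t|.

Lemma integral_absM_gauss_weight : (\int[mu]_t (`|t| * gw t)%:E = 2%:E)%E.
Proof.
rewrite ge0_symfun_integralT.
- have -> : [set x : R | 0 <= x] = `[0, +oo[%classic.
    by apply/seteqP; split => x /=; rewrite in_itv/= andbT.
  have -> : (\int[mu]_(t in `[0%R, +oo[) (`|t| * gw t)%:E =
             \int[mu]_(t in `[0%R, +oo[) ((t * 1 - 0) * gw t)%:E)%E.
    apply: eq_integral => t; rewrite inE/= in_itv/= andbT => t0.
    by rewrite ger0_norm// mulr1 subr0.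
  rewrite (@gauss_tail_FTC _ (cst 1) (cst 0) 1).
  + by rewrite /gauss_weight expr0n/= oppr0 mul0r expR0 mulr1 mule1.
  + by move=> t _; exact: cvg_cst.
  + by move=> t t0; rewrite mulr1 subr0.
  + by move=> t _; rewrite /= normr1.
- by move=> t; rewrite mulr_ge0.
- move=> t; apply: cvgM; first exact: norm_continuous.
  exact: continuous_gauss_weight.
- by move=> t /=; rewrite normrN gauss_weightN.
Qed.

Lemma integrable_affine_growth f : affine_growth f ->
  mu.-integrable [set: R] (EFin \o (fun t => f t * gw t)).
Proof.
move=> [mf [A [B fAB]]].
have iabs : mu.-integrable [set: R] (EFin \o (fun t => `|t| * gw t)).
  apply/integrableP; split.
    apply/measurable_EFinP/measurable_funM.
      by apply: continuous_measurable_fun; exact: norm_continuous.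
    exact: measurable_gauss_weight.
  under eq_integral do rewrite /= normrM normr_id (ger0_norm (gw_ge0 _)).
  by rewrite integral_absM_gauss_weight ltry.
apply: (@le_integrable_real _ _ R mu setT _ (fun t => A * gw t + B * (`|t| * gw t))) => //.
- by apply: measurable_funM => //; exact: measurable_gauss_weight.
- move=> t _; rewrite normrM (ger0_norm (gw_ge0 t)).
  by rewrite mulrA -mulrDl ler_wpM2r.
- exact: (integrableD measurableT
    (integrableZl measurableT A (integrable_gauss_weight R))
    (integrableZl measurableT B iabs)).
Qed.

Lemma affine_growth_cst c : affine_growth (cst c).
Proof.
split; first exact: measurable_cst.
by exists `|c|, 0 => t; rewrite mul0r addr0.
Qed.

Lemma affine_growth_id : affine_growth id.
Proof.
split; first exact: measurable_id.
by exists 0, 1 => t; rewrite mul1r add0r.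
Qed.

Lemma affine_growthD f g : affine_growth f -> affine_growth g ->
  affine_growth (fun t => f t + g t).
Proof.
move=> [mf [A [B fAB]]] [mg [A' [B' gAB]]].
split; first exact: measurable_funD.
exists (A + A'), (B + B') => t; rewrite (le_trans (ler_normD _ _))//.
by rewrite mulrDl addrACA lerD.
Qed.

Lemma affine_growthN f : affine_growth f -> affine_growth (fun t => - f t).
Proof.
move=> [mf [A [B fAB]]]; split; first exact: measurableT_comp.
by exists A, B => t; rewrite normrN.
Qed.

Lemma integrable_upper_tail f x : affine_growth f ->
  mu.-integrable `[x, +oo[ (EFin \o (fun t => f t * gw t)).
Proof.
move=> /integrable_affine_growth; apply: integrableS => //.
Qed.

Lemma integrable_lower_tail f x : affine_growth f ->
  mu.-integrable `]-oo, x] (EFin \o (fun t => f t * gw t)).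
Proof.
move=> /integrable_affine_growth; apply: integrableS => //.
Qed.

Lemma lower_upper_tail f x : affine_growth f ->
  lower_tail f x + upper_tail f x = \int[mu]_t (f t * gw t).
Proof.
move=> fg; rewrite /lower_tail /upper_tail -set_itvNyy.
rewrite -Rintegral_itv_obnd_cbnd; last first.
  by apply: integrableS (integrable_affine_growth fg).
rewrite -(@Rintegral_itvB _ _ -oo%O +oo%O x)//; last first.
  by rewrite set_itvNyy; exact: integrable_affine_growth.
by rewrite addrC subrK.
Qed.

Lemma upper_tailD f g x : affine_growth f -> affine_growth g ->
  upper_tail (fun t => f t + g t) x = upper_tail f x + upper_tail g x.
Proof.
move=> fg gg; rewrite /upper_tail; under eq_Rintegral do rewrite mulrDl.
by rewrite RintegralD//; exact: integrable_upper_tail.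
Qed.

Lemma lower_tailD f g x : affine_growth f -> affine_growth g ->
  lower_tail (fun t => f t + g t) x = lower_tail f x + lower_tail g x.
Proof.
move=> fg gg; rewrite /lower_tail; under eq_Rintegral do rewrite mulrDl.
by rewrite RintegralD//; exact: integrable_lower_tail.
Qed.

Lemma upper_tail_le f g x : affine_growth f -> affine_growth g ->
  (forall t, x <= t -> f t <= g t) -> upper_tail f x <= upper_tail g x.
Proof.
move=> fg gg fgx; apply: le_Rintegral => //.
- exact: integrable_upper_tail.
- exact: integrable_upper_tail.
- by move=> t /=; rewrite in_itv/= andbT => xt; rewrite ler_wpM2r// fgx.
Qed.

Lemma lower_tail_le f g x : affine_growth f -> affine_growth g ->
  (forall t, t <= x -> f t <= g t) -> lower_tail f x <= lower_tail g x.
Proof.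
move=> fg gg fgx; apply: le_Rintegral => //.
- exact: integrable_lower_tail.
- exact: integrable_lower_tail.
- by move=> t /=; rewrite in_itv/= => xt; rewrite ler_wpM2r// fgx.
Qed.

Definition upper_mass := upper_tail (cst 1).
Definition lower_mass := lower_tail (cst 1).

Lemma upper_tail_cst c x : upper_tail (cst c) x = c * upper_mass x.
Proof.
rewrite /upper_mass /upper_tail -RintegralZl//.
  by apply: eq_Rintegral => t _ /=; rewrite mul1r.
exact: (integrable_upper_tail x (affine_growth_cst 1)).
Qed.

Lemma lower_tail_cst c x : lower_tail (cst c) x = c * lower_mass x.
Proof.
rewrite /lower_mass /lower_tail -RintegralZl//.
  by apply: eq_Rintegral => t _ /=; rewrite mul1r.
exact: (integrable_lower_tail x (affine_growth_cst 1)).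
Qed.

Lemma lower_upper_mass x : lower_mass x + upper_mass x = gauss_mass R.
Proof.
rewrite lower_upper_tail; last exact: affine_growth_cst.
by under eq_Rintegral do rewrite mul1r; exact: Rintegral_gauss_weight.
Qed.

Lemma upper_mass_ge0 x : 0 <= upper_mass x.
Proof. by apply: Rintegral_ge0 => t _; rewrite mul1r. Qed.

Lemma lower_mass_ge0 x : 0 <= lower_mass x.
Proof. by apply: Rintegral_ge0 => t _; rewrite mul1r. Qed.

Lemma upper_tailN f x : (forall t, 0 <= f t) -> continuous f ->
  upper_tail (f \o -%R) (- x) = lower_tail f x.
Proof.
move=> f0 cf; rewrite /lower_tail /upper_tail -[in RHS](opprK x) /Rintegral.
rewrite ge0_integration_by_substitutionNy.
- by congr fine; apply: eq_integral => t _ /=; rewrite gauss_weightN.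
- apply: continuous_subspaceT => t; apply: cvgM; first exact: cf.
  exact: continuous_gauss_weight.
- by move=> t _; rewrite mulr_ge0.
Qed.

Lemma upper_massN x : upper_mass (- x) = lower_mass x.
Proof.
by rewrite /lower_mass -upper_tailN// => t; exact: cvg_cst.
Qed.

Lemma lower_massN x : lower_mass (- x) = upper_mass x.
Proof. by rewrite -upper_massN opprK. Qed.

End gaussian_tails.

(** * Inequalities for the Mills ratio *)

Section mills_ratio.
Context (R : realType).
Local Notation mu := (@lebesgue_measure R).
Local Notation gw := (@gauss_weight R).
Local Notation U := (@upper_mass R).
Local Notation G := (@lower_mass R).
Implicit Types (x t : R).

Let gw_gt0 x : 0 < gw x. Proof. exact: gauss_weight_gt0. Qed.
Let gw_ge0 x : 0 <= gw x. Proof. exact: gauss_weight_ge0. Qed.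

Lemma Rintegral_gauss_tail (L dL : R -> R) (C x : R) :
  (forall t, x <= t -> is_derive t 1 L (dL t)) ->
  (forall t, x <= t -> {for t, continuous dL}) ->
  (forall t, x <= t -> 0 <= t * L t - dL t) ->
  (forall t, x <= t -> `|L t| <= C) ->
  mu.-integrable `[x, +oo[ (EFin \o (fun t => (t * L t - dL t) * gw t)) /\
  \int[mu]_(t in `[x, +oo[) ((t * L t - dL t) * gw t) = L x * gw x.
Proof.
move=> DL cL pos LC; have FTC := gauss_tail_FTC DL cL pos LC.
split; last by rewrite /Rintegral FTC.
apply/integrableP; split.
  apply/measurable_EFinP/measurable_funM; last first.
    by apply: measurable_funTS; exact: measurable_gauss_weight.
  apply: subspace_continuous_measurable_fun => //.
  apply: continuous_in_subspaceT => t; rewrite inE/= in_itv/= andbT => xt.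
  apply: cvgB; last exact: cL.
  apply: cvgM; first exact: cvg_id.
  apply: differentiable_continuous; apply/derivable1_diffP.
  by case: (DL t xt).
rewrite (_ : (\int[mu]_(t in _) _)%E = (L x * gw x)%:E) ?ltry// -FTC.
apply: eq_integral => t; rewrite inE/= in_itv/= andbT => xt.
by rewrite ger0_norm// mulr_ge0// pos.
Qed.

(** The Mills ratio [M = U / gw] solves [M' = x M - 1], while [N = L / K] is
    bounded with [N' >= x N - 1]; integrated against [gw] up to infinity, this
    puts [N] below [M]. *)
Lemma mills_lower (L dL : R -> R) (C K x : R) :
  (forall t, x <= t -> is_derive t 1 L (dL t)) ->
  (forall t, x <= t -> {for t, continuous dL}) ->
  (forall t, x <= t -> 0 <= t * L t - dL t <= K) ->
  (forall t, x <= t -> `|L t| <= C) ->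
  L x * gw x <= K * U x.
Proof.
move=> DL cL LK LC.
have pos t : x <= t -> 0 <= t * L t - dL t by move=> /LK /andP[].
have [iL <-] := Rintegral_gauss_tail DL cL pos LC.
rewrite -upper_tail_cst; apply: le_Rintegral => //.
  by apply: integrable_upper_tail; exact: affine_growth_cst.
move=> t /=; rewrite in_itv/= andbT => xt; rewrite ler_wpM2r//.
by have /andP[] := LK t xt.
Qed.

(** On [[x, +oo[] with [0 <= x] the integrand [t * gw t] is nonnegative and has
    the primitive [- gw].  Reflection gives the lower tail for [x <= 0], so the
    integral over the whole line is zero, and the two remaining cases follow by
    taking complements. *)
Lemma tail_id x : upper_tail id x = gw x /\ lower_tail id x = - gw x.
Proof.
have pos y : 0 <= y -> upper_tail id y = gw y.
  move=> y0; have [|||_] := @Rintegral_gauss_tail (cst 1) (cst 0) 1 y.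
  - by move=> t _; exact: cvg_cst.
  - by move=> t yt; rewrite mulr1 subr0 (le_trans y0).
  - by move=> t _; rewrite /= normr1.
  by rewrite mul1r => <-; apply: eq_Rintegral => t _; rewrite mulr1 subr0.
have low y : y <= 0 -> lower_tail id y = - gw y.
  move=> y0; rewrite -gauss_weightN -(pos (- y)) ?oppr_ge0//.
  (* The reflection lemma is about nonnegative functions: [- t] is replaced by
     its positive part, with the same values on the half-line. *)
  pose ng t : R := Num.max 0 (- t).
  have cng : continuous ng.
    by move=> t; apply: continuous_max; [exact: cvg_cst|apply: cvgN; exact: cvg_id].
  have E1 : upper_tail id (- y) = upper_tail (ng \o -%R) (- y).
    apply: eq_Rintegral => t; rewrite inE/= in_itv/= andbT => yt.
    by rewrite /ng opprK max_r// (le_trans _ yt)// oppr_ge0.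
  rewrite E1 upper_tailN//; last by move=> t; rewrite /ng le_max lexx.
  rewrite /lower_tail -mulN1r -RintegralZl//.
    apply: eq_Rintegral => t; rewrite inE/= in_itv/= => ty.
    by rewrite /ng max_r ?mulrA ?mulN1r ?opprK// oppr_ge0 (le_trans ty).
  apply: integrable_lower_tail; split.
    by apply: continuous_measurable_fun.
  exists 0, 1 => t; rewrite mul1r add0r /ng.
  by case: (leP 0 (- t)) => _; rewrite ?normrN ?normr0.
have := lower_upper_tail x (affine_growth_id R).
rewrite -(lower_upper_tail 0 (affine_growth_id R)).
rewrite (low 0)// (pos 0)// addNr => /eqP.
have [x0|/ltW x0] := leP 0 x.
  by rewrite (pos x)// addr_eq0 => /eqP.
by rewrite (low x)// addrC subr_eq0 => /eqP.
Qed.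

Lemma upper_tail_id x : upper_tail id x = gw x.
Proof. by case: (tail_id x). Qed.

Lemma lower_tail_id x : lower_tail id x = - gw x.
Proof. by case: (tail_id x). Qed.

Lemma mills_upper x : x * U x <= gw x.
Proof.
rewrite -upper_tail_cst -upper_tail_id; apply: upper_tail_le => //.
  exact: affine_growth_cst.
exact: affine_growth_id.
Qed.

Lemma mills_lower_feller x : x * gw x <= (1 + x ^+ 2) * U x.
Proof.
have [x0|x0] := leP x 0.
  by rewrite (@le_trans _ _ 0) ?mulr_le0_ge0// mulr_ge0 ?addr_ge0 ?sqr_ge0 ?upper_mass_ge0.
have tn0 t : x <= t -> t != 0 by move=> xt; rewrite gt_eqF// (lt_le_trans x0).
have := @mills_lower (fun t => t^-1) (fun t => - t ^- 2) x^-1 (1 + x ^- 2) x.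
have H1 t : x <= t -> is_derive t 1 (fun t => t^-1) (- t ^- 2).
  move=> xt; have ? := is_deriveV (f := id) (tn0 _ xt) (is_derive_id t 1).
  by apply: is_derive_eq; rewrite /GRing.scale/= mulr1.
have H2 t : x <= t -> {for t, continuous (fun t : R => - t ^- 2)}.
  move=> xt; apply: cvgN; apply: cvgV; first by rewrite expf_neq0// tn0.
  exact: exprn_continuous.
move=> /(_ H1 H2) H.
have {H} : x^-1 * gw x <= (1 + x ^- 2) * U x.
  apply: H => t xt.
    rewrite mulfV ?tn0// opprK addr_ge0//= ?invr_ge0 ?sqr_ge0//.
    rewrite lerD2l lef_pV2 ?posrE ?exprn_gt0 ?(lt_le_trans x0)//.
    by rewrite lerXn2r// nnegrE ?ltW// (lt_le_trans x0).
  rewrite ger0_norm ?invr_ge0 ?(le_trans (ltW x0))// lef_pV2 ?posrE//.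
  exact: lt_le_trans xt.
rewrite -(ler_pM2l (exprn_gt0 2 x0)) !mulrA mulrDr mulr1.
by rewrite expr2 mulfK ?gt_eqF// -expr2 mulfV ?expf_neq0 ?gt_eqF// [x ^+ 2 + 1]addrC.
Qed.

(** The bound that [mills_product] needs near [x = 0], where Feller's lower bound
    vanishes. *)
Lemma mills_lower_quadratic x : 0 <= x ->
  (2 * x + 1) * gw x <= (2 * x ^+ 2 + 2 * x + 1) * U x.
Proof.
move=> x0; pose Q t : R := 2 * t ^+ 2 + 2 * t + 1.
have Q1 t : x <= t -> 1 <= Q t by move=> xt; rewrite /Q; nra.
have Q0 t : x <= t -> 0 < Q t by move=> /Q1; exact: lt_le_trans.
have Qn0 t : x <= t -> Q t != 0 by move=> /Q0 /gt_eqF ->.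
pose L t : R := (2 * t + 1) * (Q t)^-1.
pose dL t : R := - (4 * t * (t + 1)) * (Q t)^-2.
have DQ t : is_derive t 1 Q (4 * t + 2).
  by apply: is_derive_eq; rewrite /GRing.scale/=; ring.
have DL t : x <= t -> is_derive t 1 L (dL t).
  move=> xt; have ? := is_deriveV (Qn0 t xt) (DQ t).
  rewrite /L; apply: is_derive_eq; rewrite /GRing.scale/= /dL /Q.
  by field; exact: Qn0.
have cL t : x <= t -> {for t, continuous dL}.
  move=> xt; apply: cvgM.
    apply: cvgN; apply: cvgM.
      by apply: cvgM; [exact: cvg_cst|exact: cvg_id].
    by apply: cvgD; [exact: cvg_id|exact: cvg_cst].
  apply: cvgV; first by rewrite expf_neq0// Qn0.
  apply: (@cvg_comp _ _ _ Q (fun y => y ^+ 2) _ (nbhs (Q t))).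
    apply: differentiable_continuous; apply/derivable1_diffP.
    by case: (DQ t).
  exact: exprn_continuous.
have LE t : x <= t -> (2 * t + 1) * (Q t)^-1 * Q t = 2 * t + 1.
  by move=> xt; rewrite mulfVK// Qn0.
have tL t : x <= t -> 0 <= t * L t - dL t <= 1.
  move=> xt; have t0 := le_trans x0 xt.
  have -> : t * L t - dL t =
      (t * (2 * t + 1) * Q t + 4 * t * (t + 1)) / (Q t) ^+ 2.
    by rewrite /L /dL; field; exact: Qn0.
  rewrite divr_ge0 ?sqr_ge0//=; last first.
    by rewrite addr_ge0 ?mulr_ge0 ?addr_ge0 ?mulr_ge0// ltW ?Q0.
  rewrite ler_pdivrMr ?exprn_gt0 ?Q0// mul1r -subr_ge0.
  have -> : (Q t) ^+ 2 - (t * (2 * t + 1) * Q t + 4 * t * (t + 1)) =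
      (t + 1) * (t ^+ 2 + (t - 1) ^+ 2) by rewrite /Q; ring.
  by rewrite mulr_ge0 ?addr_ge0 ?sqr_ge0.
have LC t : x <= t -> `|L t| <= 1.
  move=> xt; have t0 := le_trans x0 xt.
  rewrite ger0_norm /L ?divr_ge0 ?addr_ge0 ?mulr_ge0// ?(ltW (Q0 _ _))//.
  by rewrite ler_pdivrMr ?Q0// mul1r /Q; nra.
have := mills_lower DL cL tL LC.
rewrite mul1r /L mulrAC ler_pdivrMr ?Q0// [U x * _]mulrC; exact.
Qed.

(** Up to the factor [gw x * I], the left-hand side is the value at [x] of
    [`|psi'|] for [h t = - `|t - x|], which is extremal among 1-Lipschitz
    functions; its two factors are the integrals of [`|t - x|] over the two
    half-lines. *)
Lemma mills_product x :
  2 * (gw x - x * U x) * (gw x + x * G x) <= gw x * gauss_mass R.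
Proof.
wlog x0 : x / 0 <= x.
  move=> H; have [/H//|/ltW x0] := leP 0 x.
  have := H (- x); rewrite oppr_ge0 gauss_weightN upper_massN lower_massN.
  by move=> /(_ x0); apply: le_trans; rewrite le_eqVlt; apply/orP; left;
    apply/eqP; ring.
have GE : G x = gauss_mass R - U x by rewrite -(lower_upper_mass x) addrK.
have I2 := gauss_mass_ge2 R.
have g1 := gauss_weight_le1 x.
have up := mills_upper x; have lo := mills_lower_quadratic x0.
have g0 := gw_gt0 x; have u0 := upper_mass_ge0 x.
rewrite GE; move: (gw x) (U x) (gauss_mass R) g1 up lo g0 u0 I2 => e u I.
move=> e1 up lo e0 u0 I2.
pose Q := 2 * x ^+ 2 + 2 * x + 1; pose s := Q * u - (2 * x + 1) * e.
have Q0 : 0 < Q by rewrite /Q; nra.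
have s0 : 0 <= s by rewrite subr_ge0.
(* For the Mills ratio [M = u / e] this is [x M ^+ 2 + 2 <= 2 (1 + x) M], a
   quadratic inequality that holds between the quadratic lower bound and
   [1 / x]. *)
have P0 : x * u ^+ 2 - 2 * (1 + x) * u * e + 2 * e ^+ 2 <= 0.
  rewrite -(pmulr_rle0 _ (exprn_gt0 2 Q0)).
  have -> : Q ^+ 2 * (x * u ^+ 2 - 2 * (1 + x) * u * e + 2 * e ^+ 2) =
    - (s * (Q * (e - x * u) + e * ((2 * x + 1) * Q - x * (2 * x + 1))))
    - x * e ^+ 2 by rewrite /s /Q; ring.
  rewrite subr_le0 lerNl (le_trans (_ : - (x * e ^+ 2) <= 0))//.
    by rewrite oppr_le0 mulr_ge0// sqr_ge0.
  rewrite mulr_ge0// addr_ge0// mulr_ge0 ?subr_ge0 ?(ltW e0) ?(ltW Q0)//.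
  by rewrite /Q; nra.
pose b := e - x * u.
have b0 : 0 <= b by rewrite subr_ge0.
have bE : b ^+ 2 + 2 * x * b * e <= e ^+ 2.
  rewrite -subr_le0.
  have -> : b ^+ 2 + 2 * x * b * e - e ^+ 2 =
    x * (x * u ^+ 2 - 2 * (1 + x) * u * e + 2 * e ^+ 2) by rewrite /b; ring.
  by rewrite mulr_ge0_le0.
(* Multiplied by [e], the left-hand side is [2 e b ^+ 2 + 2 x b e I]; since
   [e <= 1] and [2 <= I], the factor [2 e] is at most [I]. *)
rewrite -/b -(ler_pM2r e0).
have -> : 2 * b * (e + x * (I - u)) * e = 2 * e * b ^+ 2 + 2 * x * b * e * I.
  by rewrite /b; ring.
have : I * (b ^+ 2 + 2 * x * b * e) <= I * e ^+ 2.
  by rewrite ler_wpM2l// (le_trans _ I2).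
have : 2 * e * b ^+ 2 <= I * b ^+ 2 by rewrite ler_wpM2r ?sqr_ge0//; nra.
by lra.
Qed.

End mills_ratio.

(** * Stein solutions as combinations of tail integrals *)

Section normal_law.
Context (R : realType).
Local Notation mu := (@lebesgue_measure R).
Local Notation gw := (@gauss_weight R).
Local Notation normal01 := (@normal_prob R 0 1).

(** The density of the normal law is its Radon-Nikodym derivative, for which the
    change of variables holds for nonnegative functions; the general case
    treats the positive and negative parts separately. *)
Lemma integral_normal_prob01 (f : R -> \bar R) : measurable_fun [set: R] f ->
  (\int[normal01]_x f x = \int[mu]_x (f x * (normal_pdf 0 1 x)%:E))%E.
Proof.
move=> mf; pose q := Radon_Nikodym_SigmaFinite.f normal01 mu.
have numu : normal01 `<< mu by exact: normal_prob_dominates.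
have mpdf : measurable_fun [set: R] (fun x => (normal_pdf 0 1 x)%:E).
  by apply/measurable_EFinP; exact: measurable_normal_pdf.
have mq : measurable_fun [set: R] q.
  exact: measurable_int (Radon_Nikodym_SigmaFinite.f_integrable numu).
have qE : ae_eq mu setT q (fun x => (normal_pdf 0 1 x)%:E).
  apply: integral_ae_eq => //.
  - exact: Radon_Nikodym_SigmaFinite.f_integrable.
  - by move=> E _ mE; rewrite -Radon_Nikodym_SigmaFinite.f_integral.
have nonneg (g : R -> \bar R) : (forall x, 0 <= g x)%E ->
    measurable_fun [set: R] g ->
    (\int[normal01]_x g x = \int[mu]_x (g x * (normal_pdf 0 1 x)%:E))%E.
  move=> g0 mg.
  rewrite -(Radon_Nikodym_SigmaFinite.change_of_variables numu g0)//.
  apply: ae_eq_integral => //.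
  - exact: emeasurable_funM.
  - exact: emeasurable_funM.
  - exact: ae_eqe_mul2l.
rewrite integralE [RHS]integralE !nonneg//; last 2 first.
- exact: measurable_funeneg.
- exact: measurable_funepos.
congr (_ - _)%E; apply: eq_integral => x _.
- by rewrite !funeposE muleC maxe_pMr ?lee_fin ?normal_pdf_ge0// mule0 muleC.
- by rewrite !funenegE muleC maxe_pMr ?lee_fin ?normal_pdf_ge0// mule0 muleN muleC.
Qed.

End normal_law.

Section stein_solution_tails.
Context (R : realType).
Local Notation mu := (@lebesgue_measure R).
Local Notation gw := (@gauss_weight R).
Local Notation U := (@upper_mass R).
Local Notation G := (@lower_mass R).
Local Notation I := (gauss_mass R).
Implicit Types (x t z c : R) (h : R -> R).

Let gw_gt0 x : 0 < gw x. Proof. exact: gauss_weight_gt0. Qed.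
Let gw_ge0 x : 0 <= gw x. Proof. exact: gauss_weight_ge0. Qed.
Let I_gt0 : 0 < I. Proof. exact: gauss_mass_gt0. Qed.

Lemma gauss_mean_mass h : affine_growth h ->
  \int[mu]_t (h t * gw t) = gauss_mean h * I.
Proof.
move=> hg; have [mh _] := hg.
rewrite /gauss_mean {2}/Rintegral integral_normal_prob01; last first.
  exact/measurable_EFinP.
rewrite -[fine _]/(\int[mu]_x (h x * normal_pdf 0 1 x)).
rewrite -RintegralZr//.
  by apply: eq_Rintegral => t _; rewrite normal_pdf01E mulrA divfK// gt_eqF.
have -> : (fun x => h x * normal_pdf 0 1 x) = (fun x => I^-1 * (h x * gw x)).
  by apply/funext => t; rewrite normal_pdf01E mulrA mulrC.
exact: (integrableZl measurableT I^-1 (integrable_affine_growth hg)).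
Qed.

Let affineB h c : affine_growth h -> affine_growth (fun t => h t - c).
Proof.
by move=> hg; apply: (affine_growthD hg); exact: (affine_growth_cst (- c)).
Qed.

Lemma tails_centered h c x : affine_growth h ->
  lower_tail (fun t => h t - c) x + upper_tail (fun t => h t - c) x =
  (gauss_mean h - c) * I.
Proof.
move=> hg; rewrite lower_upper_tail; last exact: affineB.
rewrite mulrBl -gauss_mean_mass// -[X in _ - c * X](lower_upper_mass 0) mulrDr.
rewrite -lower_tail_cst -upper_tail_cst lower_upper_tail; last first.
  exact: affine_growth_cst.
rewrite -RintegralB//.
- by apply: eq_Rintegral => t _; rewrite mulrBl.
- exact: integrable_affine_growth.
- exact: (integrable_affine_growth (affine_growth_cst c)).
Qed.

Lemma stein_sol_lower_tail h x :
  stein_sol h x = lower_tail (fun t => h t - gauss_mean h) x / gw x.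
Proof.
by rewrite /stein_sol mulrC /gw mulNr expRN invrK.
Qed.

(** Subtracting the constant [c] from [h] does not change its Stein solution,
    and both parts of the Stein equation become combinations of the two tail
    integrals of [h - c], with coefficients that do not depend on [h]. *)
Lemma stein_sol_tails h c x : affine_growth h ->
  stein_sol h x * (gw x * I) =
  lower_tail (fun t => h t - c) x * U x - upper_tail (fun t => h t - c) x * G x.
Proof.
move=> hg; rewrite stein_sol_lower_tail mulrA divfK; last by rewrite gt_eqF.
have -> : (fun t => h t - gauss_mean h) =
    (fun t => (h t - c) + cst (c - gauss_mean h) t).
  by apply/funext => t; rewrite addrA subrK.
rewrite lower_tailD; [|exact: affineB|exact: affine_growth_cst].
rewrite lower_tail_cst mulrDl.
have := tails_centered c x hg; rewrite -(lower_upper_mass x).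
move: (lower_tail _ x) (upper_tail _ x) => a b E.
have -> : (c - gauss_mean h) * G x * (G x + U x) =
  - (((gauss_mean h - c) * (G x + U x)) * G x) by ring.
by rewrite -E; ring.
Qed.

(** The right-hand side of the Stein equation solved for the derivative, a total
    function that is easier to handle than [stein_sol' h]. *)
Definition stein_deriv h x := x * stein_sol h x + h x - gauss_mean h.

Lemma stein_deriv_tails h x : affine_growth h ->
  stein_deriv h x * (gw x * I) =
  lower_tail (fun t => h t - h x) x * (x * U x - gw x) -
  upper_tail (fun t => h t - h x) x * (x * G x + gw x).
Proof.
move=> hg; rewrite /stein_deriv -addrA mulrDl -mulrA (stein_sol_tails (h x) x hg).
have -> : (h x - gauss_mean h) * (gw x * I) =
  - ((gauss_mean h - h x) * I) * gw x by ring.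
by rewrite -(tails_centered (h x) x hg); ring.
Qed.

End stein_solution_tails.

Section lipschitz_stein_bounds.
Context (R : realType).
Local Notation gw := (@gauss_weight R).
Local Notation U := (@upper_mass R).
Local Notation G := (@lower_mass R).
Local Notation I := (gauss_mass R).
Variable h : R -> R.
Hypothesis hlip : 1.-lipschitz h.

Let gw_gt0 x : 0 < gw x. Proof. exact: gauss_weight_gt0. Qed.
Let gwI x : 0 < gw x * I. Proof. by rewrite mulr_gt0 ?gauss_mass_gt0. Qed.

Lemma lipschitz1_le x y : `|h x - h y| <= `|x - y|.
Proof. by have := @hlip (x, y) (conj Logic.I Logic.I); rewrite /= mul1r. Qed.

Lemma lipschitz1_continuous : continuous h.
Proof.
move=> x; apply/cvgrPdist_le => e e0; exists e => //= y /ltW xy.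
exact: le_trans (lipschitz1_le _ _) xy.
Qed.

Lemma lipschitz1_affine_growth : affine_growth h.
Proof.
split.
  by apply: continuous_measurable_fun; exact: lipschitz1_continuous.
exists `|h 0|, 1 => t; rewrite mul1r -[in leLHS](subrK (h 0) (h t)).
rewrite (le_trans (ler_normD _ _))// addrC lerD2l.
by have := lipschitz1_le t 0; rewrite subr0.
Qed.
Let hg := lipschitz1_affine_growth.

Let a x := lower_tail (fun t => h t - h x) x.
Let b x := upper_tail (fun t => h t - h x) x.

(* The comparison functions [t |-> x - t] and [t |-> t - x] on the lower and
   upper half-lines have explicit tail integrals. *)
Let a_le x : `|a x| <= x * G x + gw x.
Proof.
have lin : affine_growth (fun t => x + (- t)).
  apply: affine_growthD (affine_growth_cst x) _.
  exact: affine_growthN (affine_growth_id R).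
have lin' : affine_growth (fun t => - (x + (- t))) by exact: affine_growthN.
have hB : affine_growth (fun t => h t - h x).
  exact: affine_growthD hg (affine_growth_cst (- h x)).
have E : lower_tail (fun t => x + (- t)) x = x * G x + gw x.
  have := lower_tailD x lin (affine_growth_id R).
  have -> : (fun t => x - t + id t) = cst x.
    by apply/funext => t /=; rewrite subrK.
  by rewrite lower_tail_cst lower_tail_id => ->; rewrite subrK.
have E' : lower_tail (fun t => - (x + (- t))) x = - (x * G x + gw x).
  have := lower_tailD x lin lin'; rewrite E.
  have -> : (fun t => x - t + - (x - t)) = cst 0.
    by apply/funext => t /=; rewrite subrr.
  by rewrite lower_tail_cst mul0r => /eqP; rewrite eq_sym addr_eq0 => /eqP ->;
    rewrite opprK.
rewrite ler_norml; apply/andP; split.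
  rewrite -E'; apply: lower_tail_le => // t tx.
  have := lipschitz1_le t x; rewrite ler_norml => /andP[+ _].
  by rewrite distrC ger0_norm ?subr_ge0.
rewrite -E; apply: lower_tail_le => // t tx.
have := lipschitz1_le t x; rewrite ler_norml => /andP[_].
by rewrite distrC ger0_norm ?subr_ge0.
Qed.

Let b_le x : `|b x| <= gw x - x * U x.
Proof.
have lin : affine_growth (fun t => t + - x).
  exact: affine_growthD (affine_growth_id R) (affine_growth_cst (- x)).
have lin' : affine_growth (fun t => - (t + - x)) by exact: affine_growthN.
have hB : affine_growth (fun t => h t - h x).
  exact: affine_growthD hg (affine_growth_cst (- h x)).
have E : upper_tail (fun t => t + - x) x = gw x - x * U x.
  have := upper_tailD x lin (affine_growth_cst x).
  have -> : (fun t => t - x + cst x t) = id.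
    by apply/funext => t /=; rewrite subrK.
  by rewrite upper_tail_cst upper_tail_id => ->; rewrite addrK.
have E' : upper_tail (fun t => - (t + - x)) x = - (gw x - x * U x).
  have := upper_tailD x lin lin'; rewrite E.
  have -> : (fun t => t - x + - (t - x)) = cst 0.
    by apply/funext => t /=; rewrite subrr.
  by rewrite upper_tail_cst mul0r => /eqP; rewrite eq_sym addr_eq0 => /eqP ->;
    rewrite opprK.
rewrite ler_norml; apply/andP; split.
  rewrite -E'; apply: upper_tail_le => // t tx.
  have := lipschitz1_le t x; rewrite ler_norml => /andP[+ _].
  by rewrite ger0_norm ?subr_ge0.
rewrite -E; apply: upper_tail_le => // t tx.
have := lipschitz1_le t x; rewrite ler_norml => /andP[_].
by rewrite ger0_norm ?subr_ge0.
Qed.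

Let norm_le_gwI x (r K : R) : `|r * (gw x * I)| <= K * (gw x * I) -> `|r| <= K.
Proof. by rewrite normrM (gtr0_norm (gwI x)) ler_pM2r. Qed.

(* Common form of the next two bounds: [p] and [q] are the coefficients of the two
   tail integrals. *)
Let tails_bound x (p q K : R) :
  (x * G x + gw x) * `|p| + (gw x - x * U x) * `|q| <= K ->
  `|a x * p - b x * q| <= K.
Proof.
apply: le_trans; rewrite (le_trans (ler_normB _ _))// !normrM.
by rewrite lerD// ler_wpM2r.
Qed.

Lemma lipschitz_stein_deriv_le1 x : `|stein_deriv h x| <= 1.
Proof.
apply: (@norm_le_gwI x); rewrite mul1r stein_deriv_tails//.
apply: tails_bound; rewrite ler0_norm ?subr_le0 ?mills_upper//.
rewrite ger0_norm; last first.
  by have := mills_upper (- x); rewrite upper_massN gauss_weightN mulNr; lra.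
by rewrite (le_trans _ (mills_product x))//; lra.
Qed.

(** The expression is the derivative of [x * stein_sol h x].  Here the tail
    integrals have the coefficients of Feller's lower bound, and the bound by 1
    is attained for [h = id]. *)
Lemma lipschitz_stein_sol_deriv_le1 x :
  `|stein_sol h x + x * stein_deriv h x| <= 1.
Proof.
apply: (@norm_le_gwI x); rewrite mul1r mulrDl -mulrA.
rewrite (stein_sol_tails (h x) x hg) stein_deriv_tails//.
rewrite -/(a x) -/(b x).
have -> : a x * U x - b x * G x +
    x * (a x * (x * U x - gw x) - b x * (x * G x + gw x)) =
  a x * ((1 + x ^+ 2) * U x - x * gw x) - b x * ((1 + x ^+ 2) * G x + x * gw x).
  by ring.
apply: tails_bound.
rewrite ger0_norm ?subr_ge0 ?mills_lower_feller//.
rewrite ger0_norm; last first.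
  by have := mills_lower_feller (- x);
    rewrite upper_massN gauss_weightN mulNr sqrrN; lra.
rewrite -(lower_upper_mass x) le_eqVlt; apply/orP; left; apply/eqP; ring.
Qed.

End lipschitz_stein_bounds.

(** * Derivatives of Stein solutions *)

Section derivative_bounds.
Context (R : realType).
Implicit Types (f df : R -> R) (x y K : R).

Lemma derive_bound_lipschitz f df K x y : x <= y ->
  (forall t, x <= t <= y -> is_derive t 1 f (df t)) ->
  (forall t, x <= t <= y -> `|df t| <= K) -> `|f y - f x| <= K * (y - x).
Proof.
rewrite le_eqVlt => /predU1P[-> _ _|xy Df dfK].
  by rewrite !subrr normr0 mulr0.
have [||c cxy ->] := @MVT R f df x y xy.
- move=> t; rewrite in_itv/= => /andP[xt ty].
  by apply: Df; rewrite !ltW.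
- apply: continuous_in_subspaceT => t; rewrite inE/= in_itv/= => /Df Dt.
  by apply: differentiable_continuous; apply/derivable1_diffP; case: Dt.
- move: cxy; rewrite in_itv/= => /andP[xc cy].
  have yx : 0 < y - x by rewrite subr_gt0.
  rewrite normrM (gtr0_norm yx) ler_wpM2r ?(ltW yx)//.
  by rewrite dfK// (ltW xc) (ltW cy).
Qed.

Lemma lipschitz_derive1_le f K x :
  (forall y z, y <= z -> `|f z - f y| <= K * (z - y)) ->
  derivable f x 1 -> `|derive1 f x| <= K.
Proof.
move=> fK df; rewrite derive1E /derive.
have <- : lim (`|h^-1 *: ((f \o shift x) (h *: 1) - f x)| @[h --> 0^']) =
          `|lim (h^-1 *: ((f \o shift x) (h *: 1) - f x) @[h --> 0^'])|.
  by apply: cvg_lim => //; exact: cvg_norm.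
apply: limr_le; first exact: is_cvg_norm.
near=> h; have h0 : h != 0 by near: h; exact: nbhs_dnbhs_neq.
rewrite normrZ normfV ler_pdivrMl ?normr_gt0//= [h *: 1]mulr1.
have [hp|hn] := leP 0 h.
  have : x <= h + x by rewrite lerDr.
  by move=> /fK; rewrite addrK mulrC (ger0_norm hp).
have : h + x <= x by rewrite gerDr ltW.
move=> /fK; rewrite distrC mulrC opprD addrCA subrr addr0.
by rewrite (ltr0_norm hn).
Unshelve. all: by end_near. Qed.

Lemma lipschitz_bound_continuous f K : 0 < K ->
  (forall x y, x <= y -> `|f y - f x| <= K * (y - x)) -> continuous f.
Proof.
move=> K0 fK x; apply/cvgrPdist_le => e e0.
exists (e / K) => /=; first exact: divr_gt0.
move=> y /= /ltW; rewrite ler_pdivlMr// mulrC => /(le_trans _); apply.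
have [/fK|/ltW/fK] := leP x y => xy.
  by rewrite distrC (distrC x) (le_trans xy)// ler_wpM2l ?ler_norm ?ltW.
by rewrite (le_trans xy)// ler_wpM2l ?ler_norm ?ltW.
Qed.

End derivative_bounds.

Section stein_solution_derivative.
Context (R : realType).
Local Notation mu := (@lebesgue_measure R).
Local Notation gw := (@gauss_weight R).
Implicit Types (x y t : R) (f h : R -> R).

Let gw_gt0 x : 0 < gw x. Proof. exact: gauss_weight_gt0. Qed.

Lemma is_derive_lower_tail f x : affine_growth f -> {for x, continuous f} ->
  is_derive x 1 (lower_tail f) (f x * gw x).
Proof.
move=> fg cf.
have [||||dF F'] := @continuous_FTC1 R (fun t => f t * gw t) -oo%O x (x + 1).
- by rewrite ltrDl.
- exact: integrable_lower_tail.
- by rewrite ltNyr.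
- by apply: cvgM => //; exact: continuous_gauss_weight.
by rewrite -F' derive1E; exact: derivableP.
Qed.

Lemma is_derive_div_gauss_weight f df x : is_derive x 1 f df ->
  is_derive x 1 (fun y => f y / gw y) (df / gw x + x * (f x / gw x)).
Proof.
move=> Df; have gx : gw x != 0 by rewrite gt_eqF.
have ? := is_deriveV gx (is_derive_gauss_weight x).
apply: is_derive_eq; rewrite /GRing.scale/=; field.
exact: gx.
Qed.

Lemma is_derive_stein_sol h x : affine_growth h -> {for x, continuous h} ->
  is_derive x 1 (stein_sol h) (stein_deriv h x).
Proof.
move=> hg ch.
have -> : stein_sol h =
    (fun y => lower_tail (fun t => h t - gauss_mean h) y / gw y).
  by apply/funext => y; exact: stein_sol_lower_tail.
have hmg : affine_growth (fun t => h t - gauss_mean h).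
  by apply: (affine_growthD hg); exact: (affine_growth_cst (- gauss_mean h)).
have chm : {for x, continuous (fun t => h t - gauss_mean h)}.
  by apply: cvgB => //; exact: cvg_cst.
have := is_derive_div_gauss_weight (is_derive_lower_tail hmg chm).
by rewrite mulfK ?gt_eqF// -stein_sol_lower_tail addrC addrA.
Qed.

Lemma stein_sol'E h x : is_derive x 1 (stein_sol h) (stein_deriv h x) ->
  stein_sol' h x = stein_deriv h x.
Proof.
move=> Dx; rewrite /stein_sol'; case: ifPn => // _.
by rewrite derive1E derive_val.
Qed.

End stein_solution_derivative.

Section lipschitz_stein_solution.
Context (R : realType).
Variable h : R -> R.
Hypothesis hlip : 1.-lipschitz h.
Implicit Types x y t : R.

Lemma lipschitz_is_derive_stein_sol x :
  is_derive x 1 (stein_sol h) (stein_sol' h x).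
Proof.
have Dx : is_derive x 1 (stein_sol h) (stein_deriv h x).
  apply: is_derive_stein_sol; first exact: lipschitz1_affine_growth.
  exact: lipschitz1_continuous.
by rewrite stein_sol'E.
Qed.

Lemma lipschitz_stein_sol'E x : stein_sol' h x = stein_deriv h x.
Proof.
apply: stein_sol'E; apply: is_derive_stein_sol.
  exact: lipschitz1_affine_growth.
exact: lipschitz1_continuous.
Qed.

Lemma lipschitz_stein_sol_lip x y : x <= y ->
  `|stein_sol h y - stein_sol h x| <= 1 * (y - x).
Proof.
move=> xy; apply: (derive_bound_lipschitz (df := stein_sol' h)) => // t _.
  exact: lipschitz_is_derive_stein_sol.
by rewrite lipschitz_stein_sol'E lipschitz_stein_deriv_le1.
Qed.

(** By the Stein equation the increments of [stein_sol' h] are those of [h]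
    plus those of [x * stein_sol h x], and both functions are 1-Lipschitz. *)
Lemma lipschitz_stein_sol'_lip x y : x <= y ->
  `|stein_sol' h y - stein_sol' h x| <= 2 * (y - x).
Proof.
move=> xy.
have : `|y * stein_sol h y - x * stein_sol h x| <= 1 * (y - x).
  apply: (derive_bound_lipschitz (f := fun t => t * stein_sol h t)
    (df := fun t => stein_sol h t + t * stein_deriv h t)) => // t _; last first.
    exact: lipschitz_stein_sol_deriv_le1.
  have := lipschitz_is_derive_stein_sol t => Dt.
  by apply: is_derive_eq; rewrite /GRing.scale/= lipschitz_stein_sol'E; ring.
have := lipschitz1_le hlip y x; rewrite (@ger0_norm _ (y - x)) ?subr_ge0//.
move=> h1 h2; rewrite !lipschitz_stein_sol'E /stein_deriv.
have -> : y * stein_sol h y + h y - gauss_mean h -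
    (x * stein_sol h x + h x - gauss_mean h) =
  (y * stein_sol h y - x * stein_sol h x) + (h y - h x) by ring.
by rewrite (le_trans (ler_normD _ _))//; lra.
Qed.

End lipschitz_stein_solution.

(** * The Stein solution for the indicator of a half-line *)

Section half_line_stein_solution.
Context (R : realType).
Local Notation mu := (@lebesgue_measure R).
Local Notation gw := (@gauss_weight R).
Local Notation U := (@upper_mass R).
Local Notation G := (@lower_mass R).
Local Notation I := (gauss_mass R).
Variable z : R.
Local Notation h := (half_line z).
Implicit Types x y t : R.

Let gw_gt0 x : 0 < gw x. Proof. exact: gauss_weight_gt0. Qed.
Let I_gt0 : 0 < I. Proof. exact: gauss_mass_gt0. Qed.

Lemma half_lineE t : h t = (t <= z)%R%:R.
Proof. by rewrite /half_line indicE mem_setE in_itv/=. Qed.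

Lemma half_line_affine_growth : affine_growth h.
Proof.
split; first by apply: measurable_indic; exact: measurable_itv.
exists 1, 0 => t; rewrite mul0r addr0 half_lineE.
by case: (t <= z); rewrite /= ?normr1 ?normr0.
Qed.
Let hg := half_line_affine_growth.

Lemma gauss_mean_half_line : gauss_mean h * I = G z.
Proof.
rewrite -gauss_mean_mass// -(lower_upper_tail z hg).
have -> : upper_tail h z = 0.
  rewrite /upper_tail -Rintegral_itv_obnd_cbnd; last first.
    exact: (integrableS measurableT _ _ (integrable_affine_growth hg)).
  under eq_Rintegral => t.
    rewrite inE/= in_itv/= andbT half_lineE leNgt => ->; rewrite mul0r; over.
  by rewrite /Rintegral integral0.
rewrite addr0; apply: eq_Rintegral => t; rewrite inE/= in_itv/= => tz.
by rewrite half_lineE tz.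
Qed.

Let p1 x := (1 - gauss_mean h) * (G x / gw x).
Let p2 x := gauss_mean h * (U x / gw x).

Let meanE : gauss_mean h = G z / I.
Proof. by rewrite -gauss_mean_half_line mulfK// gt_eqF. Qed.

Let onem_meanE : 1 - gauss_mean h = U z / I.
Proof.
rewrite meanE -[1](@mulfV _ I) ?gt_eqF// -mulrBl.
by rewrite -[X in X - _](lower_upper_mass z) addrC addKr.
Qed.

Lemma stein_sol_half_line_le x : x <= z -> stein_sol h x = p1 x.
Proof.
move=> xz; rewrite stein_sol_lower_tail /p1 mulrA -lower_tail_cst.
congr (_ / _); apply: eq_Rintegral => t; rewrite inE/= in_itv/= => tx.
by rewrite half_lineE (le_trans tx xz).
Qed.

Lemma stein_sol_half_line_ge x : z <= x -> stein_sol h x = p2 x.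
Proof.
rewrite le_eqVlt => /predU1P[<-|zx].
  rewrite stein_sol_half_line_le// /p1 /p2 onem_meanE meanE.
  by field; rewrite !gt_eqF.
rewrite stein_sol_lower_tail /p2 mulrA; congr (_ / _).
have := tails_centered (gauss_mean h) x hg; rewrite subrr mul0r.
have -> : upper_tail (fun t => h t - gauss_mean h) x = - gauss_mean h * U x.
  rewrite -upper_tail_cst; apply: eq_Rintegral => t.
  rewrite inE/= in_itv/= andbT => xt.
  by rewrite half_lineE leNgt (lt_le_trans zx xt) sub0r.
by rewrite mulNr => /eqP; rewrite subr_eq0 => /eqP.
Qed.

Let dp1 x := (1 - gauss_mean h) * (1 + x * (G x / gw x)).
Let dp2 x := gauss_mean h * (x * (U x / gw x) - 1).

Let DG x : is_derive x 1 G (gw x).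
Proof.
have := @is_derive_lower_tail R (cst 1) x (affine_growth_cst 1) (cvg_cst _).
by rewrite mul1r; apply.
Qed.

Let DU x : is_derive x 1 U (- gw x).
Proof.
have -> : U = (fun y => I - G y).
  by apply/funext => y; rewrite -(lower_upper_mass y) addrC addKr.
by rewrite -[- gw x]sub0r; apply: is_deriveB.
Qed.

Let Dp1 x : is_derive x 1 p1 (dp1 x).
Proof.
have := is_derive_div_gauss_weight (DG x); rewrite divff ?gt_eqF// => ?.
by apply: is_derive_eq; rewrite /GRing.scale/= /dp1; ring.
Qed.

Let Dp2 x : is_derive x 1 p2 (dp2 x).
Proof.
have := is_derive_div_gauss_weight (DU x); rewrite mulNr divff ?gt_eqF// => ?.
by apply: is_derive_eq; rewrite /GRing.scale/= /dp2; ring.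
Qed.

Let upper_mass_le x y : x <= y -> U y <= U x.
Proof.
move=> xy; have iU t := integrable_upper_tail t (affine_growth_cst (1 : R)).
rewrite /upper_mass /upper_tail /Rintegral.
apply: fine_le; rewrite ?(integrable_fin_num _ (iU _))//.
apply: ge0_subset_integral => //.
- exact: measurable_int (iU x).
- by move=> t _; rewrite lee_fin mul1r ltW.
- by apply: subset_itvr; rewrite bnd_simp.
Qed.

Let lower_mass_le x y : x <= y -> G x <= G y.
Proof. by move=> xy; rewrite -!upper_massN upper_mass_le// lerN2. Qed.

(* On the left of [z] the mass [U z] is at most [U x], and then the bound comes
   down to [G x + U x = I] and the upper Mills bounds; the right side is
   symmetric. *)
Let dp1_le1 x : x <= z -> `|dp1 x| <= 1.
Proof.
move=> xz; have gx := gw_gt0 x.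
have Ux := upper_mass_ge0 x; have Gx := lower_mass_ge0 x.
have Uz : 0 <= U z <= U x.
  by rewrite upper_mass_ge0 upper_mass_le.
rewrite /dp1 onem_meanE.
have m1 := mills_upper x.
have m2 : - x * G x <= gw x.
  by have := mills_upper (- x); rewrite upper_massN gauss_weightN.
have -> : U z / I * (1 + x * (G x / gw x)) = U z * (gw x + x * G x) / (gw x * I).
  by field; rewrite !gt_eqF.
have gI : 0 < gw x * I by rewrite mulr_gt0.
rewrite normrM normfV (gtr0_norm gI) ler_pdivrMr// mul1r.
have /andP[Uz0 Uzx] := Uz.
rewrite ger0_norm ?mulr_ge0//; last by lra.
rewrite (le_trans (ler_wpM2r _ Uzx))//; first by lra.
rewrite -(lower_upper_mass x).
have : G x * (x * U x) <= G x * gw x by rewrite ler_wpM2l.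
lra.
Qed.

Let dp2_le1 x : z <= x -> `|dp2 x| <= 1.
Proof.
move=> zx; have gx := gw_gt0 x.
have Ux := upper_mass_ge0 x; have Gx := lower_mass_ge0 x.
have Gz0 := lower_mass_ge0 z; have Gzx := lower_mass_le zx.
have m1 := mills_upper x.
have m2 : - x * G x <= gw x.
  by have := mills_upper (- x); rewrite upper_massN gauss_weightN.
rewrite /dp2 meanE.
have -> : G z / I * (x * (U x / gw x) - 1) =
    - (G z * (gw x - x * U x)) / (gw x * I).
  by field; rewrite !gt_eqF.
have gI : 0 < gw x * I by rewrite mulr_gt0.
rewrite normrM normfV (gtr0_norm gI) ler_pdivrMr// mul1r normrN.
rewrite ger0_norm ?mulr_ge0//; last by lra.
rewrite (le_trans (ler_wpM2r _ Gzx))//; first by lra.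
rewrite -(lower_upper_mass x).
have : (- x * G x) * U x <= gw x * U x by rewrite ler_wpM2r.
lra.
Qed.

(** The two smooth branches are 1-Lipschitz on their sides and meet at [z]. *)
Lemma half_line_stein_sol_lip x y : x <= y ->
  `|stein_sol h y - stein_sol h x| <= 1 * (y - x).
Proof.
have left u v : u <= v -> v <= z ->
    `|stein_sol h v - stein_sol h u| <= 1 * (v - u).
  move=> uv vz; rewrite !stein_sol_half_line_le// ?(le_trans uv)//.
  apply: (derive_bound_lipschitz (df := dp1)) => // t /andP[_ tv].
  by rewrite dp1_le1// (le_trans tv).
have right u v : u <= v -> z <= u ->
    `|stein_sol h v - stein_sol h u| <= 1 * (v - u).
  move=> uv zu; rewrite !stein_sol_half_line_ge// ?(le_trans zu)//.
  apply: (derive_bound_lipschitz (df := dp2)) => // t /andP[ut _].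
  by rewrite dp2_le1// (le_trans zu).
move=> xy; have [yz|/ltW zy] := leP y z; first exact: left.
have [zx|/ltW xz] := leP z x; first exact: right.
rewrite (le_trans (ler_distD (stein_sol h z) _ _))//.
have := left _ _ xz (lexx z); have := right _ _ zy (lexx z); lra.
Qed.

Let derive_lt x : x < z -> is_derive x 1 (stein_sol h) (dp1 x).
Proof.
move=> xz; apply: near_eq_is_derive (Dp1 x); near=> y.
by rewrite stein_sol_half_line_le// ltW//; near: y; exact: lt_nbhsl.
Unshelve. all: by end_near. Qed.

Let derive_gt x : z < x -> is_derive x 1 (stein_sol h) (dp2 x).
Proof.
move=> zx; apply: near_eq_is_derive (Dp2 x); near=> y.
by rewrite stein_sol_half_line_ge// ltW//; near: y; exact: lt_nbhsr.
Unshelve. all: by end_near. Qed.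

(** Wherever [stein_sol' h] is a true derivative the Lipschitz property bounds
    it; its conventional value at [z] is the derivative of the left branch. *)
Lemma half_line_stein_sol'_le1 x : `|stein_sol' h x| <= 1.
Proof.
rewrite /stein_sol'; case: ifPn => [/asboolP dx|/asboolP ndx].
  exact: (lipschitz_derive1_le half_line_stein_sol_lip).
have -> : x = z.
  apply/eqP; apply: contrapT => /negP; rewrite neq_lt => /orP[xz|zx]; apply: ndx.
    by case: (derive_lt xz).
  by case: (derive_gt zx).
rewrite half_lineE lexx stein_sol_half_line_le//.
have -> : z * p1 z + 1%:R - gauss_mean h = dp1 z by rewrite /p1 /dp1; ring.
exact: dp1_le1.
Qed.

Lemma measurable_half_line_stein_sol' : measurable_fun [set: R] (stein_sol' h).
Proof.
have mG (m : R -> R) : (forall x, derivable m x 1) ->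
    measurable_fun [set: R] (fun x => m x / gw x).
  move=> Dm; apply: continuous_measurable_fun => x.
  apply: cvgM.
    by apply: differentiable_continuous; apply/derivable1_diffP; exact: Dm.
  by apply: cvgV; [rewrite gt_eqF|exact: continuous_gauss_weight].
have mdp1 : measurable_fun [set: R] dp1.
  apply: measurable_funM => //; apply: measurable_funD => //.
  by apply: measurable_funM => //; apply: mG => x; case: (DG x).
have mdp2 : measurable_fun [set: R] dp2.
  apply: measurable_funM => //; apply: measurable_funB => //.
  by apply: measurable_funM => //; apply: mG => x; case: (DU x).
have E : stein_sol' h = (fun x => if x < z then dp1 x else
    if x == z then stein_sol' h z else dp2 x).
  apply/funext => x; case: ltgtP => [xz|zx|->//].
  - have Dx := derive_lt xz; rewrite /stein_sol' asboolT; last by case: Dx.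
    by rewrite derive1E derive_val.
  - have Dx := derive_gt zx; rewrite /stein_sol' asboolT; last by case: Dx.
    by rewrite derive1E derive_val.
rewrite E; apply: measurable_fun_ifT => //.
  exact: measurable_fun_ltr.
apply: measurable_fun_ifT => //.
exact: measurable_fun_eqr.
Qed.

End half_line_stein_solution.

(** * Integral remainders *)

Section taylor_remainder.
Context (R : realType).
Local Notation mu := (@lebesgue_measure R).
Implicit Types (f df : R -> R) (K M a b : R).

Lemma lipschitz_bound_sym f K :
  (forall x y, x <= y -> `|f y - f x| <= K * (y - x)) ->
  forall x y, `|f x - f y| <= K * `|x - y|.
Proof.
move=> fK x y; have [xy|/ltW yx] := leP x y.
  have yx0 : 0 <= y - x by rewrite subr_ge0.
  by rewrite distrC (distrC x) (ger0_norm yx0) fK.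
have xy0 : 0 <= x - y by rewrite subr_ge0.
by rewrite (ger0_norm xy0) fK.
Qed.

(* The difference of the two sides is a function of [a] that is nondecreasing
   before [b] and nonincreasing after. *)
Let taylor_upper f df K a b :
  (forall x : R, is_derive x 1 f (df x)) ->
  (forall x y, x <= y -> df y - df x <= K * (y - x)) ->
  f a - f b - df b * (a - b) <= K / 2 * (a - b) ^+ 2.
Proof.
move=> Df dfK.
pose p t := f t - f b - df b * (t - b) - K / 2 * (t - b) ^+ 2.
pose dp t := df t - df b - K * (t - b).
have Dp (t : R) : is_derive t 1 p (dp t).
  have := Df t => ?; apply: is_derive_eq.
  by rewrite /GRing.scale/= /dp; field.
have pb : p b = 0 by rewrite /p; ring.
have cp (x y : R) : {within `[x, y], continuous p}.
  apply: continuous_subspaceT => t; apply: differentiable_continuous.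
  by apply/derivable1_diffP; case: (Dp t).
suff : p a <= 0 by rewrite /p; lra.
have [ab|ba|->] := ltgtP a b; last by rewrite pb.
- have [c] := @MVT R p dp a b ab (fun t _ => Dp t) (cp _ _).
  rewrite in_itv/= => /andP[ac cb]; rewrite pb sub0r => pE.
  rewrite -oppr_ge0 pE mulr_ge0 ?subr_ge0 ?(ltW ab)// /dp.
  by have := dfK c b (ltW cb); lra.
- have [c] := @MVT R p dp b a ba (fun t _ => Dp t) (cp _ _).
  rewrite in_itv/= => /andP[bc ca]; rewrite pb subr0 => ->.
  rewrite mulr_le0_ge0 ?subr_ge0 ?(ltW ba)// /dp.
  by have := dfK b c (ltW bc); lra.
Qed.

Lemma taylor_remainder_bound f df K a b :
  (forall x : R, is_derive x 1 f (df x)) ->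
  (forall x y, x <= y -> `|df y - df x| <= K * (y - x)) ->
  `|f a - f b - df b * (a - b)| <= K / 2 * (a - b) ^+ 2.
Proof.
move=> Df dfK; rewrite ler_norml; apply/andP; split; last first.
  apply: taylor_upper => // x y xy.
  exact: le_trans (ler_norm _) (dfK _ _ xy).
have Dfn (x : R) : is_derive x 1 (fun x => - f x) (- df x).
  by have := Df x => ?; apply: is_derive_eq.
have := @taylor_upper (fun x => - f x) (fun x => - df x) K a b Dfn.
have dfnK x y : x <= y -> - df y - - df x <= K * (y - x).
  move=> xy; rewrite -opprD (le_trans _ (dfK _ _ xy))//.
  by rewrite (le_trans (ler_norm _))// normrN.
by move=> /(_ dfnK); lra.
Qed.

(** The integrand need not be differentiable everywhere: on the segment,
    [u |-> (1 - u) * df (u a + (1 - u) b) + f (u a + (1 - u) b) / (a - b)] is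
    Lipschitz, [df] is differentiable wherever this function is, and its
    derivative there is [a - b] times the integrand. *)
Lemma taylor_integral_remainder f df K M a b : 0 <= K -> 0 <= M ->
  (forall x : R, is_derive x 1 f (df x)) -> (forall x, `|df x| <= M) ->
  (forall x y, x <= y -> `|df y - df x| <= K * (y - x)) ->
  f a - f b - df b * (a - b) = (a - b) ^+ 2 *
    \int[mu]_(u in `[0, 1]) ((1 - u) * derive1 df (u * a + (1 - u) * b)).
Proof.
move=> K0 M0 Df dfM dfK.
have [->|ab] := eqVneq a b; first by rewrite !subrr mulr0 expr0n/= mul0r subrr.
pose c := a - b; have c0 : c != 0 by rewrite subr_eq0.
pose y u : R := u * a + (1 - u) * b.
have yE u v : y u - y v = (u - v) * c by rewrite /y /c; ring.
pose g u := df (y u).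
pose H u := ((1 - u) * g u + f (y u) / c) / c.
have Dy (u : R) : is_derive u 1 y c.
  by apply: is_derive_eq; rewrite /GRing.scale/= /c; ring.
rewrite (@lipschitz_FTC R H _ ((K * `|c| + M + M) / `|c|) 0 1)//.
- have y1 : y 1 = a by rewrite /y; ring.
  have y0 : y 0 = b by rewrite /y; ring.
  by rewrite /H /g y1 y0 -/c; field.
- by rewrite divr_ge0// !addr_ge0// mulr_ge0.
- move=> u v u0 uv v1.
  have gK : `|g v - g u| <= K * `|c| * (v - u).
    rewrite (le_trans (lipschitz_bound_sym dfK _ _))// yE normrM.
    by rewrite (@ger0_norm _ (v - u)) ?subr_ge0// mulrAC mulrA.
  have fM : `|f (y v) - f (y u)| <= M * `|c| * (v - u).
    have fL s t : s <= t -> `|f t - f s| <= M * (t - s).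
      by move=> st; exact: (derive_bound_lipschitz (df := df)).
    rewrite (le_trans (lipschitz_bound_sym fL _ _))// yE normrM.
    by rewrite (@ger0_norm _ (v - u)) ?subr_ge0// mulrAC mulrA.
  have -> : H v - H u = ((1 - v) * (g v - g u) - (v - u) * g u +
      (f (y v) - f (y u)) / c) / c by rewrite /H; field.
  rewrite normrM normfV mulrAC ler_wpM2r ?invr_ge0//.
  have -> : (K * `|c| + M + M) * (v - u) =
      K * `|c| * (v - u) + M * (v - u) + M * (v - u) by ring.
  rewrite (le_trans (ler_normD _ _))// lerD//.
    rewrite (le_trans (ler_normB _ _))// lerD// normrM.
      rewrite (le_trans _ gK)// ler_piMl// ger0_norm ?subr_ge0//.
      by rewrite gerBl (le_trans u0).
    by rewrite ger0_norm ?subr_ge0// mulrC ler_wpM2r ?subr_ge0// /g dfM.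
  by rewrite normrM normfV ler_pdivrMr ?normr_gt0// mulrAC fM.
- move=> u u0 u1 dH.
  have u1n0 : 1 - u != 0 by rewrite subr_eq0 gt_eqF.
  have Dfy (v : R) : is_derive v 1 (fun u => f (y u)) (df (y v) * c).
    exact: (is_derive1_comp (Df (y v)) (Dy v)).
  have Dinv : is_derive u 1 (fun v : R => (1 - v)^-1) ((1 - u) ^- 2).
    have D1 : is_derive u 1 (fun v : R => 1 - v) (- 1).
      by rewrite -[- 1]sub0r; apply: is_deriveB.
    have ? := is_deriveV (f := fun v : R => 1 - v) u1n0 D1.
    by apply: is_derive_eq; rewrite /GRing.scale/= mulrN1 opprK.
  have dg : derivable g u 1.
    apply: (@near_eq_derivable _ _ _
      (fun v => (H v * c - f (y v) / c) * (1 - v)^-1)); last first.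
      have dfy : derivable (fun v => f (y v)) u 1 by case: (Dfy u).
      apply: derivableM; last by case: Dinv.
      apply: derivableB; apply: derivableM.
      - exact: dH.
      - exact: derivable_cst.
      - exact: dfy.
      - exact: derivable_cst.
    near=> v; have v1 : 1 - v != 0.
      by rewrite subr_eq0 gt_eqF//; near: v; exact: lt_nbhsl.
    by rewrite /H; field; rewrite c0 v1.
  have Dg : is_derive u 1 g (derive1 g u).
    by rewrite derive1E; exact: derivableP.
  pose yi x := (x - b) / c.
  have yiK : yi (y u) = u by rewrite /yi /y /c; field.
  have dfE : df = g \o yi.
    apply/funext => x /=; rewrite /g; congr df; rewrite /y /yi /c; field.
    exact: c0.
  have Dyi : is_derive (y u) 1 yi c^-1.
    by apply: is_derive_eq; rewrite /GRing.scale/=; ring.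
  have Ddf : is_derive (y u) 1 df (derive1 g u / c).
    have Dg' : is_derive (yi (y u)) 1 g (derive1 g u) by rewrite yiK.
    by rewrite dfE; exact: (is_derive1_comp Dg' Dyi).
  have -> : derive1 df (u * a + (1 - u) * b) = derive1 g u / c.
    by rewrite derive1E -/(y u) derive_val.
  rewrite derive1E.
  have : is_derive u 1 H ((1 - u) * (derive1 g u / c)).
    have ? := Dfy u; rewrite /H; apply: is_derive_eq.
    by rewrite /GRing.scale/= /g; field.
  by case.
Unshelve. all: by end_near. Qed.

End taylor_remainder.

Section oriented_remainder.
Context (R : realType).
Implicit Types (f df : R -> R) (c e D : R).

(** The right-hand side is the increment over [0, D] of the Lipschitz function
    [t |-> c * t - f (e + t)], which is differentiable at [t] only if [f] is
    differentiable at [e + t]. *)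
Lemma oriented_integral_remainder f df c e D :
  (forall x y, x <= y -> `|f y - f x| <= 1 * (y - x)) ->
  (forall x, derivable f x 1 -> df x = derive1 f x) ->
  oriented_integral 0 D (fun t => c - df (e + t)) = c * D - (f (e + D) - f e).
Proof.
move=> fL fdf; pose H t := c * t - f (e + t).
have HL x y : x <= y -> `|H y - H x| <= (`|c| + 1) * (y - x).
  move=> xy; have -> : H y - H x = c * (y - x) - (f (e + y) - f (e + x)).
    by rewrite /H; ring.
  have yx : 0 <= y - x by rewrite subr_ge0.
  rewrite (le_trans (ler_normB _ _))// normrM (ger0_norm yx) mulrDl lerD2l.
  have exy : e + x <= e + y by rewrite lerD2l.
  by have := fL _ _ exy; rewrite opprD addrACA subrr add0r.
have DH t : derivable H t 1 -> derive1 H t = c - df (e + t).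
  move=> dH; pose s x := x - e.
  have Ds (x : R) : is_derive x 1 s 1.
    by rewrite -[1 in X in is_derive _ _ _ X]subr0; apply: is_deriveB.
  have set_s : s (e + t) = t by rewrite /s addrC addKr.
  have fE : f = (fun x => c * s x - (H \o s) x).
    by apply/funext => x; rewrite /H /s/= subrKC; ring.
  have D1 : is_derive (s (e + t)) 1 H (derive1 H t).
    by rewrite set_s derive1E; exact: derivableP.
  have D2 := is_derive1_comp D1 (Ds (e + t)).
  have D3 : is_derive (e + t) 1 f (c - derive1 H t).
    rewrite {1}fE; have ? := Ds (e + t).
    by apply: is_derive_eq; rewrite /GRing.scale/=; ring.
  rewrite fdf; last by case: D3.
  by rewrite [derive1 f _]derive1E (@derive_val _ _ _ _ _ _ _ D3); ring.
have c1 : 0 <= `|c| + 1 by rewrite addr_ge0.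
have H0 : H 0 = - f e by rewrite /H mulr0 addr0 sub0r.
rewrite /oriented_integral; case: ifPn => [D0|].
  rewrite (@lipschitz_FTC R H _ (`|c| + 1) 0 D)// ?H0; first by rewrite /H; ring.
  - by move=> x y _ xy _; exact: HL.
  - by move=> x _ _; exact: DH.
rewrite -ltNge => /ltW D0.
rewrite (@lipschitz_FTC R H _ (`|c| + 1) D 0)// ?H0; first by rewrite /H; ring.
- by move=> x y _ xy _; exact: HL.
- by move=> x _ _; exact: DH.
Qed.

End oriented_remainder.

(** * The expansion of D_k psi (F) *)

Section expansion.
Context d (Omega : measurableType d) (R : realType) (P : probability Omega R).
Context (dT : nat -> measure_display) (T : forall n, measurableType (dT n)).
Variable X : forall n, {RV P >-> T n}.
Implicit Types J : set nat.

Let gen J := \bigcup_(n in J) preimage_set_system setT (X n) measurable.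

Let gen_measurable J : gen J `<=` measurable.
Proof. by move=> _ [n _ [B mB <-]]; exact: measurable_funP. Qed.

Lemma sigma_except_sub k :
  sigma_except X k `<=` sigma_generated X setT.
Proof.
apply: smallest_sub; first exact: smallest_sigma_algebra.
by move=> A [n _ nA]; apply: sub_gen_smallest; exists n.
Qed.

Lemma L_X_measurable (r : \bar R) (F : Omega -> R) : L_X X r F ->
  measurable_fun [set: g_sigma_algebraType (gen setT)]
    (F : g_sigma_algebraType (gen setT) -> R).
Proof. by move=> [/sub_sigma_measurable_funP]. Qed.

Lemma L_X2_integrable (F : Omega -> R) : L_X X 2%:E F ->
  P.-integrable setT (EFin \o F).
Proof.
move=> [_ F2]; apply/Lfun1_integrable.
apply: Lfun_subset F2 => //.
- by rewrite lee_fin ler1n.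
- exact: fin_num_measure.
- by rewrite lee_fin ler1n.
Qed.

Variables (F : Omega -> R) (k : nat).
Hypothesis FL2 : L_X X 2%:E F.
Local Notation EG := (cond_exp P (sigma_except X k)).
Local Notation EF := (EG F).
Local Notation DF := (D_op X k F).

Let iF : P.-integrable setT (EFin \o F). Proof. exact: L_X2_integrable. Qed.

Let EFP : is_cond_exp P (sigma_except X k) F EF.
Proof. exact: (cond_exp_spec (@gen_measurable _) iF). Qed.

Let mGEF : measurable_fun [set: g_sigma_algebraType (gen [set n | n != k])]
    (EF : g_sigma_algebraType (gen [set n | n != k]) -> R).
Proof. by have [[/sub_sigma_measurable_funP]] := EFP. Qed.

Let mXEF : measurable_fun [set: g_sigma_algebraType (gen setT)]
    (EF : g_sigma_algebraType (gen setT) -> R).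
Proof.
apply/sub_sigma_measurable_funP => A EA; apply: sigma_except_sub.
by have [[+ _] _] := EFP; exact.
Qed.

Let iEF : P.-integrable setT (EFin \o EF).
Proof. by have [[_ /Lfun1_integrable]] := EFP. Qed.

Let iDF : P.-integrable setT (EFin \o DF).
Proof. exact: (integrableB measurableT iF iEF). Qed.

Let DF0 A : sigma_except X k A -> (\int[P]_(w in A) (DF w)%:E = 0)%E.
Proof.
move=> GA; have mA := sub_sigma_measurable (@gen_measurable _) GA.
have sub f : P.-integrable setT f -> P.-integrable A f.
  by move=> ?; exact: (integrableS measurableT).
have iA := sub _ iF; have iEA := sub _ iEF.
rewrite /D_op integralB_EFin//; have [_ ->//] := EFP.
by rewrite subee// integrable_fin_num.
Qed.

(* From here on only these three properties of the Stein solution and of its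
   derivative matter. *)
Variables psi dpsi : R -> R.
Hypothesis psi_lip : forall x y, x <= y -> `|psi y - psi x| <= 1 * (y - x).
Hypothesis dpsi_le1 : forall x, `|dpsi x| <= 1.
Hypothesis mdpsi : measurable_fun [set: R] dpsi.

Let mpsi : measurable_fun [set: R] psi.
Proof.
by apply: continuous_measurable_fun; exact: lipschitz_bound_continuous psi_lip.
Qed.

Let integrable_psi (Y : Omega -> R) : P.-integrable setT (EFin \o Y) ->
  P.-integrable setT (EFin \o (psi \o Y)).
Proof.
move=> iY; have /measurable_EFinP mY := measurable_int _ iY.
apply: (le_integrable_real (g := fun w => `|psi 0| + `|Y w|)) => //.
- exact: measurableT_comp.
- move=> w _ /=; rewrite -[psi (Y w)](subrK (psi 0)) addrC.
  rewrite (le_trans (ler_normD _ _))// lerD2l.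
  by have := lipschitz_bound_sym psi_lip (Y w) 0; rewrite mul1r subr0.
- have ic : P.-integrable setT (EFin \o cst `|psi 0|).
    by apply/Lfun1_integrable; exact: Lfun_cst.
  exact: (integrableD measurableT ic (integrable_norm iY)).
Qed.

Variables Rk Sk : Omega -> R.
Hypothesis RkE :
  forall w, psi (F w) - psi (EF w) = dpsi (EF w) * DF w + Rk w.
Hypothesis SkE :
  forall w, psi (EF w) - psi (F w) = dpsi (F w) * (- DF w) + Sk w.

Let Rk_def : Rk = (fun w => psi (F w) - psi (EF w) - dpsi (EF w) * DF w).
Proof. by apply/funext => w; rewrite RkE addrC addKr. Qed.

Let mXF := L_X_measurable FL2.

Let idpsiDF : P.-integrable setT (EFin \o (fun w => dpsi (EF w) * DF w)).
Proof.
apply: (le_integrable_real (g := fun w => `|DF w|)) => //.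
- apply: measurable_funM.
    by apply: measurableT_comp => //; exact/measurable_EFinP/(measurable_int _ iEF).
  exact/measurable_EFinP/(measurable_int _ iDF).
- by move=> w _; rewrite normrM ler_piMl.
- exact: integrable_norm.
Qed.

Let iRk : P.-integrable setT (EFin \o Rk).
Proof.
rewrite Rk_def.
exact: (integrableB measurableT
  (integrableB measurableT (integrable_psi iF) (integrable_psi iEF)) idpsiDF).
Qed.

Lemma expansion_L_X : L_X X 1%E (psi \o F) /\ L_X X 1%E Rk.
Proof.
have mXpsiF := measurableT_comp mpsi mXF.
split; split.
- exact/sub_sigma_measurable_funP.
- by apply/Lfun1_integrable; exact: integrable_psi.
- apply/sub_sigma_measurable_funP; rewrite Rk_def.
  apply: measurable_funB; first apply: measurable_funB => //.
    exact: measurableT_comp mXEF.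
  apply: measurable_funM; first exact: measurableT_comp mXEF.
  exact: measurable_funB.
- exact/Lfun1_integrable.
Qed.

(** The random variable [psi (E[F | G_k])] is its own conditional expectation,
    and the factor [dpsi (E[F | G_k])] can be pulled out in front of
    [E[D_k F | G_k] = 0]. *)
Lemma expansion_D_op : {ae P, forall w,
  D_op X k (psi \o F) w = dpsi (F w) * DF w - Sk w - EG Rk w}.
Proof.
have subG := @gen_measurable [set n | n != k].
have ipsiF := integrable_psi iF; have ipsiEF := integrable_psi iEF.
have c1 : is_cond_exp P (sigma_except X k) (psi \o EF) (psi \o EF).
  apply: cond_exp_measurable => //; exact: measurableT_comp mGEF.
have c2 := cond_exp_spec subG iRk.
have c3 : is_cond_exp P (sigma_except X k) (fun w => dpsi (EF w) * DF w) (cst 0).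
  apply: (cond_exp_pull_out (M := 1) subG iDF DF0) => //.
  exact: measurableT_comp mGEF.
have iRD : P.-integrable setT (EFin \o (Rk \+ (fun w => dpsi (EF w) * DF w))).
  exact: (integrableD measurableT iRk idpsiDF).
have := cond_expD subG ipsiEF iRD c1 (cond_expD subG iRk idpsiDF c2 c3).
have -> : (psi \o EF) \+ (Rk \+ (fun w => dpsi (EF w) * DF w)) = psi \o F.
  by apply/funext => w /=; rewrite Rk_def; ring.
move=> /(cond_exp_unique subG (cond_exp_spec subG ipsiF)).
apply: filterS => w /= Ew.
have {}Ew : EG (psi \o F) w = psi (EF w) + EG Rk w by rewrite [LHS]Ew addr0.
by have := SkE w; rewrite /D_op Ew /=; lra.
Qed.

Lemma expansion_remainders_le w :
  Num.max `|Rk w| `|Sk w| <= 2 * `|DF w|.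
Proof.
have psiD : `|psi (F w) - psi (EF w)| <= `|DF w|.
  by have := lipschitz_bound_sym psi_lip (F w) (EF w); rewrite mul1r.
have dD x : `|dpsi x * DF w| <= `|DF w| by rewrite normrM ler_piMl.
rewrite ge_max; apply/andP; split.
  rewrite Rk_def (le_trans (ler_normB _ _))//.
  by have := dD (EF w); lra.
have -> : Sk w = dpsi (F w) * DF w - (psi (F w) - psi (EF w)).
  by have := SkE w; lra.
rewrite (le_trans (ler_normB _ _))//.
by have := dD (F w); lra.
Qed.

End expansion.

Theorem proposition3p2 (R : realType) (d : measure_display)
    (Omega : measurableType d) (P : probability Omega R)
    (dT : nat -> measure_display) (T : forall n, measurableType (dT n))
    (X : forall n, {RV P >-> T n}) (F : Omega -> R) (h : R -> R) (k : nat)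
    (Rk Sk : Omega -> R) :
  let G := sigma_except X k in
  let EF := cond_exp P G F in
  let DF := D_op X k F in
  let psi := stein_sol h in
  let psi' := stein_sol' h in
  let psi'' := stein_sol'' h in
  mutually_independent X ->
  L_X X 2%:E F ->
  (1.-lipschitz h \/ exists z : R, h = half_line z) ->
  (forall w, psi (F w) - psi (EF w) = psi' (EF w) * DF w + Rk w) ->
  (forall w, psi (EF w) - psi (F w) = psi' (F w) * (- DF w) + Sk w) ->
  [/\ L_X X 1%E (psi \o F) /\ L_X X 1%E Rk,
      {ae P, forall w,
        D_op X k (psi \o F) w = psi' (F w) * DF w - Sk w - cond_exp P G Rk w},
      1.-lipschitz h ->
        [/\ {ae P, forall w, Sk w = DF w ^+ 2 *
               \int[lebesgue_measure]_(u in `[0, 1])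
                 ((1 - u) * psi'' (u * EF w + (1 - u) * F w))},
            {ae P, forall w, Rk w = DF w ^+ 2 *
               \int[lebesgue_measure]_(u in `[0, 1])
                 ((1 - u) * psi'' (u * F w + (1 - u) * EF w))} &
            {ae P, forall w, Num.max `|Rk w| `|Sk w| <=
                             Num.min (DF w ^+ 2) (2 * `|DF w|)}] &
      forall z : R, h = half_line z ->
        {ae P, forall w, Num.max `|Rk w| `|Sk w| <= 2 * `|DF w|} /\
        {ae P, forall w, Sk w =
           oriented_integral 0 (DF w) (fun t => psi' (F w) - psi' (EF w + t))}].
Proof.
move=> G EF DF psi psi' psi'' _ FL2 hh RkE SkE.
have psi_lip x y : x <= y -> `|psi y - psi x| <= 1 * (y - x).
  case: hh => [hlip|[z hz]]; first exact: lipschitz_stein_sol_lip.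
  by rewrite /psi hz; exact: half_line_stein_sol_lip.
have psi'_le1 x : `|psi' x| <= 1.
  case: hh => [hlip|[z hz]].
    by rewrite /psi' lipschitz_stein_sol'E// lipschitz_stein_deriv_le1.
  by rewrite /psi' hz; exact: half_line_stein_sol'_le1.
have mpsi' : measurable_fun [set: R] psi'.
  case: hh => [hlip|[z hz]]; last first.
    by rewrite /psi' hz; exact: measurable_half_line_stein_sol'.
  apply: continuous_measurable_fun; apply: (@lipschitz_bound_continuous _ _ 2) => //.
  exact: lipschitz_stein_sol'_lip.
have DFE w : DF w = F w - EF w by [].
have RkEw w : Rk w = psi (F w) - psi (EF w) - psi' (EF w) * (F w - EF w).
  by have := RkE w; rewrite DFE => ->; rewrite addrC addKr.
have SkEw w : Sk w = psi (EF w) - psi (F w) - psi' (F w) * (EF w - F w).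
  by have := SkE w; rewrite DFE opprB => ->; rewrite addrC addKr.
have le2 := expansion_remainders_le psi_lip psi'_le1 RkE SkE.
split.
- exact: (expansion_L_X FL2 psi_lip psi'_le1 mpsi' RkE).
- exact: (expansion_D_op FL2 psi_lip psi'_le1 mpsi' RkE SkE).
- move=> hlip.
  have Dpsi := lipschitz_is_derive_stein_sol hlip.
  have psi'_lip := lipschitz_stein_sol'_lip hlip.
  have taylor a b := taylor_integral_remainder a b (ler0n R 2) ler01 Dpsi
    psi'_le1 psi'_lip.
  have bound a b : `|psi a - psi b - psi' b * (a - b)| <= (a - b) ^+ 2.
    have := taylor_remainder_bound a b Dpsi psi'_lip.
    by rewrite divff ?pnatr_eq0// mul1r.
  split; apply: aeW => w /=.
  + by rewrite SkEw taylor DFE -sqrrN opprB.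
  + by rewrite RkEw taylor.
  + rewrite le_min le2 andbT ge_max RkEw SkEw bound DFE -[(F w - _) ^+ 2]sqrrN.
    by rewrite opprB bound.
- move=> z hz; split; apply: aeW => w /=; first exact: le2.
  rewrite (oriented_integral_remainder _ _ _ psi_lip).
    by rewrite SkEw DFE subrKC; ring.
  by move=> x dx; rewrite /psi' /stein_sol' asboolT.
Qed.
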